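(* Let $X$ be an infinite-dimensional complex Banach space and let $R\in\mathcal{B}(X)$ be a Riesz operator. If $T\in\mathcal{B}(X)$ satisfies property $(Z_{\Pi_a})$ and commutes with $R$, then the following statements are equivalent: (i) $T+R$ satisfies property $(Z_{\Pi_a})$; (ii) $\Pi^0(T+R)=\Pi_a(T+R)$; (iii) $\Pi_a(T+R)\cap\sigma(T)\subset\Pi^0(T)$.
   Context: $\mathcal{B}(X)$ is the algebra of bounded linear operators on $X$ and $I$ is the identity. For $S\in\mathcal{B}(X)$, $\mathcal{N}(S)$ and $\mathcal{R}(S)$ are its null space and range, $\sigma(S)$ its spectrum, and $\sigma_a(S)$ its approximate point spectrum ($\lambda\in\sigma_a(S)$ iff $S-\lambda I$ is not bounded below). $S\in\mathcal{B}(X)$ is Fredholm if $\dim\mathcal{N}(S)<\infty$ and $\operatorname{codim}\mathcal{R}(S)<\infty$, with index $\dim\mathcal{N}(S)-\operatorname{codim}\mathcal{R}(S)$; it is Weyl if it is Fredholm of index $0$. The Weyl spectrum is $\sigma_W(S)=\{\lambda\in\mathbb{C}: S-\lambda I \text{ is not Weyl}\}$. An operator $R\in\mathcal{B}(X)$ is Riesz if $R-\mu I$ is Fredholm for every nonzero $\mu\in\mathbb{C}$. The ascent and descent of $S$ are $a(S)=\inf\{n\in\mathbb{N}:\mathcal{N}(S^n)=\mathcal{N}(S^{n+1})\}$ and $\delta(S)=\inf\{n\in\mathbb{N}:\mathcal{R}(S^n)=\mathcal{R}(S^{n+1})\}$, with $\mathbb{N}=\{0,1,2,\dots\}$ and $\inf\emptyset=\infty$.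 $\lambda\in\sigma(S)$ is a pole of $S$ if $S-\lambda I$ has finite ascent and finite descent; it is of finite rank if $\dim\mathcal{N}(S-\lambda I)<\infty$. $\lambda\in\sigma_a(S)$ is a left pole of $S$ if $a(S-\lambda I)<\infty$ and $\mathcal{R}((S-\lambda I)^{a(S-\lambda I)+1})$ is closed. $\Pi^0(S)$ is the set of poles of $S$ of finite rank and $\Pi_a(S)$ the set of left poles of $S$. $S$ satisfies property $(Z_{\Pi_a})$ if $\sigma(S)\setminus\sigma_W(S)=\Pi_a(S)$. *)

(* Defs.v *)
From HB Require Import structures.
From mathcomp Require Import all_boot all_order all_algebra.
From mathcomp Require Import complex.
From mathcomp Require Import all_classical all_reals all_analysis.
Import Order.TTheory GRing.Theory Num.Theory.
Import numFieldNormedType.Exports.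

Set Implicit Arguments.
Unset Strict Implicit.
Unset Printing Implicit Defensive.

Local Open Scope classical_set_scope.
Local Open Scope ring_scope.

(* Infimum in N U {oo}, where [None] stands for oo. *)
Definition nat_inf (A : set nat) : option nat :=
  if pselect (exists n, `[< A n >]) is left exA then Some (ex_minn exA)
  else None.

Section LinearAlgebra.
Context {F : fieldType} {V : lmodType F}.
Implicit Types (U W : set V) (S : V -> V).

Definition null_space S : set V := [set x | S x = 0].

(* For subspaces U of W: the classes of b 0, ..., b (n-1) form a basis of the
   quotient space W/U. *)
Definition quotient_basis U W n (b : 'I_n -> V) : Prop :=
  [/\ forall i, W (b i),
      forall x, W x -> exists c : 'I_n -> F, U (x - \sum_(i < n) c i *: b i)
    & forall c : 'I_n -> F,
        U (\sum_(i < n) c i *: b i) -> forall i, c i = 0].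

Definition has_dim W n : Prop :=
  exists b : 'I_n -> V, quotient_basis [set 0] W b.
Definition has_codim U n : Prop :=
  exists b : 'I_n -> V, quotient_basis U setT b.

Definition finite_dim W : Prop := exists n, has_dim W n.
Definition finite_codim U : Prop := exists n, has_codim U n.

(* Meaningful only when [finite_dim W], resp. [finite_codim U]. *)
Definition dim W : nat := xget 0%N [set n | has_dim W n].
Definition codim U : nat := xget 0%N [set n | has_codim U n].

Definition ascent S : option nat :=
  nat_inf [set n | null_space (iter n S) = null_space (iter n.+1 S)].
Definition descent S : option nat :=
  nat_inf [set n | range (iter n S) = range (iter n.+1 S)].

Definition fredholm S : Prop :=
  finite_dim (null_space S) /\ finite_codim (range S).
Definition fredholm_index S : int := (dim (null_space S))%:Z - (codim (range S))%:Z.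
Definition weyl S : Prop := fredholm S /\ fredholm_index S = 0.

End LinearAlgebra.

Section Operators.
Context {K : realType} {X : completeNormedModType K[i]}.
Implicit Types S : {linear X -> X}.

Definition bounded_op S : Prop :=
  exists M : K[i], forall x, `|S x| <= M * `|x|.

Definition bounded_below S : Prop :=
  exists2 c : K[i], 0 < c & forall x, c * `|x| <= `|S x|.

(* The inverse is required to be bounded: invertibility in B(X). *)
Definition invertible_op S : Prop :=
  exists U : {linear X -> X},
    [/\ bounded_op U, forall x, U (S x) = x & forall x, S (U x) = x].

Definition sub_scalar S (l : K[i]) : {linear X -> X} := S \- l \*: idfun.

Definition spectrum S : set K[i] := [set l | ~ invertible_op (sub_scalar S l)].
Definition approx_spectrum S : set K[i] :=
  [set l | ~ bounded_below (sub_scalar S l)].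
Definition weyl_spectrum S : set K[i] := [set l | ~ weyl (sub_scalar S l)].

Definition riesz S : Prop := forall m : K[i], m != 0 -> fredholm (sub_scalar S m).

Definition poles S : set K[i] :=
  [set l | [/\ spectrum S l, ascent (sub_scalar S l) <> None
             & descent (sub_scalar S l) <> None]].

Definition finite_rank_poles S : set K[i] :=
  [set l | poles S l /\ finite_dim (null_space (sub_scalar S l))].

Definition left_poles S : set K[i] :=
  [set l | approx_spectrum S l /\
     exists2 p, ascent (sub_scalar S l) = Some p
              & closed (range (iter p.+1 (sub_scalar S l)))].

Definition property_ZPia S : Prop :=
  spectrum S `\` weyl_spectrum S = left_poles S.

End Operators.

(* Main.v *)
Require Import Defs.
From HB Require Import structures.
From mathcomp Require Import all_boot all_order all_algebra.
From mathcomp Require Import complex ring_quotient generic_quotient.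
From mathcomp Require Import all_classical all_reals all_analysis.
From mathcomp Require Import ring lra.
Import Order.TTheory GRing.Theory Num.Theory.
Import numFieldNormedType.Exports.

(** Call an operator Browder when it has finite ascent, finite descent and a
    finite-dimensional null space: the poles of finite rank are the points of the
    spectrum where the shifted operator is Browder. A Browder operator is Weyl,
    and a Weyl operator of finite ascent is Browder ([browder_weyl_mod],
    [weyl_mod_browder]). Hence under the property assumed of [T], an operator
    [T - l] is Browder as soon as it is Weyl, and the equivalences follow by
    comparing [T] with [T + R], once it is known that a commuting Riesz operator
    preserves both classes: [browder_sub_quasinilpotent] and
    [weyl_mod_sub_quasinilpotent].

    Everything happens in the ring of linear maps modulo maps of finite rank,
    where being Fredholm is being invertible, with the seminorm that measures the
    distance to finite rank. A Riesz operator [r] is quasinilpotent there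
    ([riesz_powers_vanish]). The reason is elementary: for [n = 2 ^ k] the inverse
    of [1 - (z r) ^ n] is the mean of the inverses of [1 - w z r] over the [n]-th
    roots of unity [w], so that one modulus of continuity, found by compactness on
    a disc, serves all [n]. If [(s r) ^ n] tends to zero, then
    [(1 - (s r) ^ n)^-1] tends to [1]; at a slightly larger radius the inverses
    stay near [1], the powers stay bounded, and a little below that radius they
    tend to zero. The gain in radius is uniform, so every radius is reached.

    Now let [a], Weyl or Browder, commute with [r]. Up to finite rank [a] is an
    invertible operator [u], so that [a - r] is [u (1 - b)] with [b = u^-1 r],
    and the powers of [b] split as those of [u^-1] and of [r]: some power of [b]
    is the sum of an operator of small norm and one of finite rank. Then
    [1 - t b] is Fredholm for [t] in the unit interval, and its index, constant
    along this path, is zero ([weyl_mod_one_sub]). Moreover [1 - b] has finite ascent: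
    otherwise Riesz's lemma produces a bounded sequence whose images under that
    power of [b] are uniformly separated, which the finite-rank part excludes by
    the pigeonhole principle ([finite_ascent_one_sub]). If [a] is Browder, [u]
    can be taken to commute with [r], by adding to [a] its spectral projection
    at zero; the finite ascent of [1 - b] then passes to [a - r].

    The Fredholm property is a purely algebraic condition, so bounded inverses,
    closed ranges and bounded parametrices have to come from the open mapping
    theorem and, for complements of null spaces, from the Hahn-Banach theorem. *)

Set Implicit Arguments.
Unset Strict Implicit.
Unset Printing Implicit Defensive.

Local Open Scope classical_set_scope.
Local Open Scope ring_scope.

(** * Linear endomorphisms as a ring *)

(** Plain linear maps, bounded or not, are the carrier: the spectral projections
    and inverses below are first built algebraically and only then bounded. *)
Record endo (F : fieldType) (V : lmodType F) := Endo {
  endo_fun :> V -> V;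
  endo_linear : linear endo_fun }.

Section EndoRing.
Context {F : fieldType} {V : lmodType F}.
Implicit Types a b c : endo V.

HB.instance Definition _ := gen_eqMixin (endo V).
HB.instance Definition _ := gen_choiceMixin (endo V).
HB.instance Definition _ a :=
  GRing.isLinear.Build F V V *:%R (endo_fun a) (endo_linear a).

Lemma endoP a b : a =1 b -> a = b.
Proof.
case: a b => [f fl] [g gl] /= /funext fg; move: fl gl; rewrite fg => fl gl.
by rewrite (Prop_irrelevance fl gl).
Qed.

Definition endo_zero := @Endo F V \0 (linearP \0).
Definition endo_opp a := @Endo F V (\- a) (linearP (\- a)).
Definition endo_add a b := @Endo F V (a \+ b) (linearP (a \+ b)).
Definition endo_one := @Endo F V idfun (linearP idfun).
Definition endo_mul a b := @Endo F V (a \o b) (linearP (a \o b)).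

Fact endo_addA : associative endo_add.
Proof. by move=> a b c; apply: endoP => x /=; rewrite addrA. Qed.
Fact endo_addC : commutative endo_add.
Proof. by move=> a b; apply: endoP => x /=; rewrite addrC. Qed.
Fact endo_add0 : left_id endo_zero endo_add.
Proof. by move=> a; apply: endoP => x /=; rewrite add0r. Qed.
Fact endo_addN : left_inverse endo_zero endo_opp endo_add.
Proof. by move=> a; apply: endoP => x /=; rewrite addNr. Qed.
HB.instance Definition _ := GRing.isZmodule.Build (endo V)
  endo_addA endo_addC endo_add0 endo_addN.

Fact endo_mulA : associative endo_mul.
Proof. by move=> a b c; apply: endoP. Qed.
Fact endo_mul1 : left_id endo_one endo_mul.
Proof. by move=> a; apply: endoP. Qed.
Fact endo_mulr1 : right_id endo_one endo_mul.
Proof. by move=> a; apply: endoP. Qed.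
Fact endo_mulDl : left_distributive endo_mul +%R.
Proof. by move=> a b c; apply: endoP. Qed.
Fact endo_mulDr : right_distributive endo_mul +%R.
Proof. by move=> a b c; apply: endoP => x /=; rewrite linearD. Qed.
HB.instance Definition _ := GRing.Zmodule_isPzRing.Build (endo V)
  endo_mulA endo_mul1 endo_mulr1 endo_mulDl endo_mulDr.

Lemma endo0E x : (0 : endo V) x = 0. Proof. by []. Qed.
Lemma endo1E x : (1 : endo V) x = x. Proof. by []. Qed.
Lemma endoDE a b x : (a + b) x = a x + b x. Proof. by []. Qed.
Lemma endoNE a x : (- a) x = - a x. Proof. by []. Qed.
Lemma endoBE a b x : (a - b) x = a x - b x. Proof. by []. Qed.
Lemma endoME a b x : (a * b) x = a (b x). Proof. by []. Qed.
Definition endoE := (endo0E, endo1E, endoBE, endoDE, endoNE, endoME).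

Lemma endoXE a n x : (a ^+ n) x = iter n a x.
Proof. by elim: n => [|n IHn] //; rewrite exprS endoME IHn. Qed.

Fact scal_linear (z : F) : linear (fun x : V => z *: x).
Proof. by move=> t x y; rewrite scalerDr !scalerA mulrC. Qed.
Definition scal (z : F) : endo V := Endo (@scal_linear z).

Lemma scalE z x : scal z x = z *: x. Proof. by []. Qed.
Lemma scalC z a : scal z * a = a * scal z.
Proof. by apply: endoP => x; rewrite !endoE !scalE linearZ. Qed.
Lemma scalD y z : scal (y + z) = scal y + scal z.
Proof. by apply: endoP => x; rewrite /= scalerDl. Qed.
Lemma scalM y z : scal (y * z) = scal y * scal z.
Proof. by apply: endoP => x; rewrite /= scalerA. Qed.
Lemma scal1 : scal 1 = 1.
Proof. by apply: endoP => x; rewrite /= scale1r. Qed.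
Lemma scal0 : scal 0 = 0.
Proof. by apply: endoP => x; rewrite /= scale0r. Qed.

Lemma appD a x y : a (x + y) = a x + a y. Proof. exact: linearD. Qed.
Lemma appB a x y : a (x - y) = a x - a y. Proof. exact: linearB. Qed.
Lemma appN a x : a (- x) = - a x. Proof. exact: linearN. Qed.
Lemma app0 a : a 0 = 0. Proof. exact: linear0. Qed.
Lemma appZ a t x : a (t *: x) = t *: a x. Proof. exact: linearZ. Qed.
Lemma app_sum a I r (P : pred I) (E : I -> V) :
  a (\sum_(i <- r | P i) E i) = \sum_(i <- r | P i) a (E i).
Proof. exact: linear_sum. Qed.

Lemma bij_invertible a : (forall x, a x = 0 -> x = 0) ->
  (forall y, exists x, a x = y) -> exists b, a * b = 1 /\ b * a = 1.
Proof.
move=> inj /choice[g ag].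
have injE x y : a x = a y -> x = y.
  by move=> e; apply/eqP; rewrite -subr_eq0; apply/eqP/inj; rewrite appB e subrr.
have gl : linear g.
  by move=> t x y; apply: injE; rewrite appD appZ !ag.
by exists (Endo gl); split; apply: endoP => x; rewrite !endoE //=; apply: injE.
Qed.

End EndoRing.

(** * Linear independence modulo a subspace *)

Section LinearCombinations.
Context {F : fieldType} {V : lmodType F}.
Implicit Types (U W : set V) (a : endo V).

Definition is_subspace U : Prop :=
  U 0 /\ forall t x y, U x -> U y -> U (t *: x + y).

Definition lincomb n (c : 'I_n -> F) (b : 'I_n -> V) : V := \sum_(i < n) c i *: b i.

Definition indep_mod U n (b : 'I_n -> V) : Prop :=
  forall c, U (lincomb c b) -> forall i, c i = 0.

Lemma subspaceZ U t x : is_subspace U -> U x -> U (t *: x).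
Proof. by move=> [U0 UP] Ux; rewrite -[_ *: _]addr0; exact: UP. Qed.

Lemma subspaceD U x y : is_subspace U -> U x -> U y -> U (x + y).
Proof. by move=> [U0 UP] Ux Uy; rewrite -[x]scale1r; exact: UP. Qed.

Lemma subspaceN U x : is_subspace U -> U x -> U (- x).
Proof. by move=> sU Ux; rewrite -scaleN1r; exact: subspaceZ. Qed.

Lemma subspaceB U x y : is_subspace U -> U x -> U y -> U (x - y).
Proof. by move=> sU Ux Uy; apply: subspaceD => //; exact: subspaceN. Qed.

Lemma subspace_sum U n (E : 'I_n -> V) :
  is_subspace U -> (forall i, U (E i)) -> U (\sum_(i < n) E i).
Proof.
move=> sU UE; elim/big_ind: _ => //; first by case: sU.
by move=> x y; exact: subspaceD.
Qed.

Lemma subspace_lincomb U n c (b : 'I_n -> V) :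
  is_subspace U -> (forall i, U (b i)) -> U (lincomb c b).
Proof. by move=> sU Ub; apply: subspace_sum => // i; exact: subspaceZ. Qed.

Lemma subspace0 : is_subspace [set 0 : V].
Proof. by split=> // t x y -> ->; rewrite scaler0 addr0. Qed.

Lemma null_spaceP a x : null_space a x <-> a x = 0. Proof. by []. Qed.

Lemma subspace_null a : is_subspace (null_space a).
Proof.
split=> [|t x y]; rewrite /null_space /=; first exact: app0.
by rewrite appD appZ => -> ->; rewrite scaler0 addr0.
Qed.

Lemma subspace_range a : is_subspace (range a).
Proof.
split=> [|t _ _ [x _ <-] [y _ <-]]; first by exists 0 => //; exact: app0.
by exists (t *: x + y) => //; rewrite appD appZ.
Qed.

Lemma lincombD n c d (b : 'I_n -> V) :
  lincomb (fun i => c i + d i) b = lincomb c b + lincomb d b.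
Proof. by rewrite /lincomb -big_split; apply: eq_bigr => i _; rewrite scalerDl. Qed.

Lemma lincombB n c d (b : 'I_n -> V) :
  lincomb (fun i => c i - d i) b = lincomb c b - lincomb d b.
Proof. by rewrite /lincomb -sumrB; apply: eq_bigr => i _; rewrite scalerBl. Qed.

Lemma lincombZ n t c (b : 'I_n -> V) : lincomb (fun i => t * c i) b = t *: lincomb c b.
Proof. by rewrite /lincomb scaler_sumr; apply: eq_bigr => i _; rewrite scalerA. Qed.

Lemma lincomb0 n (b : 'I_n -> V) : lincomb (fun=> 0) b = 0.
Proof. by rewrite /lincomb big1 // => i _; rewrite scale0r. Qed.

Lemma eq_lincomb n c d (b : 'I_n -> V) : c =1 d -> lincomb c b = lincomb d b.
Proof. by move=> cd; apply: eq_bigr => i _; rewrite cd. Qed.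

Lemma lincomb_delta n (i : 'I_n) (b : 'I_n -> V) : lincomb (fun j => (i == j)%:R) b = b i.
Proof.
rewrite /lincomb (bigD1 i) //= eqxx scale1r big1 ?addr0 // => j ji.
by rewrite eq_sym (negbTE ji) scale0r.
Qed.

Lemma app_lincomb a n c (b : 'I_n -> V) : a (lincomb c b) = lincomb c (a \o b).
Proof. by rewrite app_sum; apply: eq_bigr => i _; rewrite appZ. Qed.

Lemma lincomb_mulmx m n (u : 'rV[F]_m) (A : 'M[F]_(m, n)) (b : 'I_n -> V) :
  \sum_(i < m) u ord0 i *: lincomb (A i) b = lincomb ((u *m A) ord0) b.
Proof.
under eq_bigr do rewrite /lincomb scaler_sumr.
rewrite exchange_big /=; apply: eq_bigr => j _.
by rewrite mxE scaler_suml; apply: eq_bigr => i _; rewrite scalerA.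
Qed.

Definition ocat T m n (b : 'I_m -> T) (d : 'I_n -> T) (i : 'I_(m + n)) : T :=
  match fintype.split i with inl j => b j | inr k => d k end.

Lemma lincomb_cat m n c d (b : 'I_m -> V) (e : 'I_n -> V) :
  lincomb (ocat c d) (ocat b e) = lincomb c b + lincomb d e.
Proof.
rewrite /lincomb big_split_ord /=; congr (_ + _); apply: eq_bigr => i _; rewrite /ocat.
  by rewrite (unsplitK (inl _ i)).
by rewrite (unsplitK (inr _ i)).
Qed.

(** A kernel vector of the coefficient matrix would be a dependence. *)
Lemma indep_mod_leq U n (b : 'I_n -> V) m (v : 'I_m -> V) :
  is_subspace U -> indep_mod U b ->
  (forall i, exists c, U (b i - lincomb c v)) -> (n <= m)%N.
Proof.
move=> sU ib /choice[a aP]; rewrite leqNgt; apply/negP => mn.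
pose A : 'M[F]_(n, m) := \matrix_(i, j) a i j.
have : kermx A != 0.
  by rewrite -mxrank_eq0 mxrank_ker subn_eq0 -ltnNge (leq_ltn_trans (rank_leq_col A)).
move=> /rowV0Pn[u /sub_kermxP uA /negP]; apply.
apply/eqP/rowP => i; rewrite [RHS]mxE; apply: (ib (u ord0)).
have -> : lincomb (u ord0) b = \sum_(i < n) u ord0 i *: (b i - lincomb (a i) v).
  have uA0 : \sum_(i < n) u ord0 i *: lincomb (A i) v = 0.
    by rewrite lincomb_mulmx uA /lincomb big1 // => j _; rewrite mxE scale0r.
  rewrite -[LHS]subr0 -[in LHS]uA0 {1}/lincomb -sumrB; apply: eq_bigr => j _.
  rewrite scalerBr; congr (_ - _ *: _).
  by apply: eq_bigr => k _; rewrite mxE.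
by apply: subspace_sum => // j; exact: subspaceZ.
Qed.

Lemma indep_mod_leq_basis U W n (b : 'I_n -> V) m (v : 'I_m -> V) :
  is_subspace U -> indep_mod U b -> (forall i, W (b i)) ->
  quotient_basis U W v -> (n <= m)%N.
Proof.
by move=> sU ib Wb [_ sp _]; apply: (indep_mod_leq sU ib) => i; exact: sp.
Qed.

Definition vcons n (x : V) (b : 'I_n -> V) (i : 'I_n.+1) : V :=
  oapp b x (unlift ord0 i).

Lemma indep_mod_cons U n x (b : 'I_n -> V) :
  is_subspace U -> indep_mod U b -> (forall c, ~ U (x - lincomb c b)) ->
  indep_mod U (vcons x b).
Proof.
move=> sU ib Nx c.
have -> : lincomb c (vcons x b) = c ord0 *: x + lincomb (c \o lift ord0) b.
  rewrite /lincomb big_ord_recl /vcons unlift_none /=; congr (_ + _).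
  by apply: eq_bigr => i _; rewrite liftK.
move=> Uc; have c0 : c ord0 = 0.
  apply/eqP/negP => /negP c0.
  apply: (Nx (fun i => - (c ord0)^-1 * c (lift ord0 i))).
  have := subspaceZ (c ord0)^-1 sU Uc.
  by rewrite lincombZ scalerDr scalerA mulVf // scale1r scaleNr opprK.
move: Uc; rewrite c0 scale0r add0r => /ib ci i.
have [j ->|->//] := unliftP ord0 i; exact: ci.
Qed.

(** A maximal independent family is a basis; [v] bounds its size. *)
Lemma exists_quotient_basis U W m (v : 'I_m -> V) :
  is_subspace U -> is_subspace W -> (forall x, W x -> exists c, U (x - lincomb c v)) ->
  exists n (b : 'I_n -> V), quotient_basis U W b.
Proof.
move=> sU sW sp.
pose P n := `[< exists b : 'I_n -> V, (forall i, W (b i)) /\ indep_mod U b >].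
have P0 : P 0%N by apply/asboolP; exists (fun=> 0); split=> [[]|? _ []].
have Pm n : P n -> (n <= m)%N.
  by move=> /asboolP[b [Wb ib]]; apply: (indep_mod_leq sU ib) => i; exact: sp.
have [n /asboolP[b [Wb ib]] nmax] := ex_maxnP (ex_intro P _ P0) Pm.
exists n, b; split=> // x Wx; apply: contrapT => Nx.
suff /nmax : P n.+1 by rewrite ltnn.
apply/asboolP; exists (vcons x b); split.
  by move=> i; rewrite /vcons; case: unliftP => [j _|_] /=.
by apply: indep_mod_cons => // c Uc; apply: Nx; exists c.
Qed.

Lemma quotient_basis_uniq U W n (b : 'I_n -> V) m (v : 'I_m -> V) :
  is_subspace U -> quotient_basis U W b -> quotient_basis U W v -> n = m.
Proof.
move=> sU qb qv; apply/eqP; rewrite eqn_leq.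
case: (qb) (qv) => Wb _ ib [Wv _ iv].
by rewrite (indep_mod_leq_basis sU ib Wb qv) (indep_mod_leq_basis sU iv Wv qb).
Qed.

Lemma quotient_basis_coord_uniq U W n (b : 'I_n -> V) c d x :
  is_subspace U -> quotient_basis U W b -> U (x - lincomb c b) -> U (x - lincomb d b) ->
  c =1 d.
Proof.
move=> sU [_ _ ib] Uc Ud i; apply/eqP; rewrite -subr_eq0; apply/eqP.
apply: (ib (fun i => c i - d i)); rewrite -/(lincomb _ _) lincombB.
have -> : lincomb c b - lincomb d b = (x - lincomb d b) - (x - lincomb c b).
  by rewrite opprB [RHS]addrC addrA subrK.
exact: subspaceB.
Qed.

Lemma quotient_basis_indep U W n (b v : 'I_n -> V) :
  is_subspace U -> quotient_basis U W b -> (forall i, W (v i)) -> indep_mod U v ->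
  quotient_basis U W v.
Proof.
move=> sU qb Wv iv; split=> // x Wx; apply: contrapT => Nx.
suff : (n.+1 <= n)%N by rewrite ltnn.
apply: (@indep_mod_leq_basis U W _ (vcons x v) _ b) => //.
  by apply: indep_mod_cons => // c Uc; apply: Nx; exists c.
by move=> i; rewrite /vcons; case: unliftP => [j _|_] /=.
Qed.

Lemma has_dim_uniq W n m : has_dim W n -> has_dim W m -> n = m.
Proof. by move=> [b qb] [v qv]; exact: quotient_basis_uniq subspace0 qb qv. Qed.

Lemma has_codim_uniq U n m :
  is_subspace U -> has_codim U n -> has_codim U m -> n = m.
Proof. by move=> sU [b qb] [v qv]; exact: quotient_basis_uniq sU qb qv. Qed.

Lemma has_dimP W : finite_dim W -> has_dim W (Defs.dim W).
Proof. exact: xgetPex. Qed.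

Lemma has_codimP U : finite_codim U -> has_codim U (codim U).
Proof. exact: xgetPex. Qed.

Lemma finite_dim_span W m (v : 'I_m -> V) :
  is_subspace W -> (forall x, W x -> exists c, x = lincomb c v) -> finite_dim W.
Proof.
move=> sW sp; apply: exists_quotient_basis subspace0 sW _ => x /sp[c xE]; exists c;
  rewrite xE; exact: subrr.
Qed.

Lemma finite_dimP W : finite_dim W ->
  exists n (b : 'I_n -> V), (forall i, W (b i)) /\
    forall x, W x -> exists c, x = lincomb c b.
Proof.
move=> [n [b [Wb sp _]]]; exists n, b; split=> // x /sp[c /eqP].
by rewrite subr_eq0 => /eqP; exists c.
Qed.

Lemma finite_dim_sub U W :
  is_subspace U -> U `<=` W -> finite_dim W -> finite_dim U.
Proof.
by move=> sU UW /finite_dimP[n [b [_ sp]]]; apply: finite_dim_span sU _ => x /UW; exact: sp.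
Qed.

(** Lift a basis of the part of [W] in the range, and complete it with a basis of
    the null space. *)
Lemma finite_dim_preimage a W :
  is_subspace W -> finite_dim (null_space a) -> finite_dim W ->
  finite_dim (a @^-1` W).
Proof.
move=> sW /finite_dimP[n [b [Nb spb]]] fW.
have sP : is_subspace (a @^-1` W).
  split=> [|t x y] /=; first by rewrite app0; case: sW.
  by rewrite appD appZ; case: sW => _; exact.
have sI : is_subspace (a @` (a @^-1` W)).
  split=> [|t _ _ [x Wx <-] [y Wy <-]]; first by exists 0; [case: sP|exact: app0].
  by exists (t *: x + y); [case: sP => _; exact|rewrite appD appZ].
have /finite_dimP[m [w [Iw spw]]] : finite_dim (a @` (a @^-1` W)).
  by apply: finite_dim_sub fW => // _ [x Wx <-].
have /choice[u uP] i : exists x, a x = w i by have [x _ <-] := Iw i; exists x.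
apply: (@finite_dim_span _ (n + m) (ocat b u)) => // x Wx.
have [c ac] : exists c, a x = lincomb c w by apply: spw; exists x.
have [|d xd] := spb (x - lincomb c u).
  by rewrite /null_space /= appB app_lincomb ac -(_ : lincomb c w = lincomb c (a \o u)) ?subrr //;
     apply: eq_bigr => i _; rewrite /= uP.
by exists (ocat d c); rewrite lincomb_cat -xd subrK.
Qed.

Lemma finite_dim_nullX a k :
  finite_dim (null_space a) -> finite_dim (null_space (a ^+ k)).
Proof.
move=> fN; elim: k => [|k IHk].
  apply: (@finite_dim_span _ 0 (fun=> 0)); first exact: subspace_null.
  by move=> x; rewrite /null_space /= => ->; exists (fun=> 0); rewrite lincomb0.
apply: finite_dim_sub (finite_dim_preimage (subspace_null (a ^+ k)) fN IHk).
  exact: subspace_null.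
by move=> x; rewrite /null_space /= exprSr.
Qed.

End LinearCombinations.

(** * Finite rank, the quotient ring, and Weyl operators *)

Section FiniteRank.
Context {F : fieldType} {V : lmodType F}.
Implicit Types a b f g u v : endo V.

Definition finite_rank : {pred endo V} := fun a => `[< finite_dim (range a) >].

Lemma finite_rankP a : reflect (finite_dim (range a)) (a \in finite_rank).
Proof. exact: asboolP. Qed.

Lemma finite_rank_span a n (v : 'I_n -> V) :
  (forall x, exists c, a x = lincomb c v) -> a \in finite_rank.
Proof.
move=> sp; apply/finite_rankP.
by apply: (finite_dim_span (subspace_range a)) => _ [x _ <-]; exact: sp.
Qed.

Lemma finite_rankE a : a \in finite_rank ->
  exists n (v : 'I_n -> V), forall x, exists c, a x = lincomb c v.
Proof.
move=> /finite_rankP/finite_dimP[n [v [_ sp]]].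
by exists n, v => x; apply: sp; exists x.
Qed.

Lemma finite_rankMl a b : b \in finite_rank -> a * b \in finite_rank.
Proof.
move=> /finite_rankE[n [v sp]]; apply: (finite_rank_span (v := a \o v)) => x.
by have [c xc] := sp x; exists c; rewrite endoME xc app_lincomb.
Qed.

Lemma finite_rankMr a b : a \in finite_rank -> a * b \in finite_rank.
Proof.
move=> /finite_rankE[n [v sp]]; apply: (finite_rank_span (v := v)) => x.
exact: sp.
Qed.

Fact finite_rank_zmod_closed : zmod_closed finite_rank.
Proof.
split=> [|a b /finite_rankE[m [v va]] /finite_rankE[n [w wb]]].
  apply: (@finite_rank_span _ 0 (fun=> 0)) => x.
  by exists (fun=> 0); rewrite lincomb0.
apply: (finite_rank_span (v := ocat v w)) => x.
have [c xc] := va x; have [d xd] := wb x.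
exists (ocat c (fun i => -1 * d i)).
by rewrite lincomb_cat lincombZ scaleN1r endoBE xc xd.
Qed.
HB.instance Definition _ :=
  GRing.isZmodClosed.Build (endo V) finite_rank finite_rank_zmod_closed.

(** In a basis of the range the coordinates are unique, hence linear. *)
Lemma finite_rank_coord f : f \in finite_rank ->
  exists n (v : 'I_n -> V) (phi : V -> 'rV[F]_n),
    linear phi /\ forall x, f x = lincomb (phi x ord0) v.
Proof.
move=> /finite_rankP[n [v qv]].
have /choice[phi phiP] x : exists r : 'rV[F]_n, f x = lincomb (r ord0) v.
  have [_ sp _] := qv; have [|c xc] := sp (f x); first by exists x.
  exists (\row_i c i); apply/eqP; rewrite -subr_eq0; apply/eqP.
  by rewrite -[RHS]xc; congr (_ - _); apply: eq_bigr => i _; rewrite mxE.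
exists n, v, phi; split=> // t x y; apply/rowP => i.
apply: (quotient_basis_coord_uniq subspace0 qv (x := f (t *: x + y))).
  by rewrite -phiP; exact: subrr.
rewrite appD appZ !phiP -lincombZ -lincombD.
rewrite (_ : lincomb _ _ = lincomb ((t *: phi x + phi y) ord0) v); first exact: subrr.
by apply: eq_lincomb => j; rewrite !mxE.
Qed.

End FiniteRank.

Section Calkin.
Context {F : fieldType} {V : lmodType F}.
Implicit Types a b f g u v : endo V.
Local Open Scope quotient_scope.

(** An algebraic stand-in for the Calkin algebra: the ideal is that of all
    finite-rank maps, with no closure taken. *)
Definition calkin := @Quotient.quot (endo V) (@finite_rank F V).
HB.instance Definition _ := GRing.Zmodule.on calkin.
HB.instance Definition _ := EqQuotient.on calkin.

Definition cls a : calkin := \pi_calkin a.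

Lemma clsP a b : cls a = cls b <-> a - b \in finite_rank.
Proof. by rewrite Quotient.idealrBE; split=> [/eqP|/eqP]. Qed.

Lemma clsD a b : cls (a + b) = cls a + cls b.
Proof. by rewrite /cls !piE. Qed.

Lemma clsN a : cls (- a) = - cls a.
Proof. by rewrite /cls !piE. Qed.

Lemma clsB a b : cls (a - b) = cls a - cls b.
Proof. by rewrite clsD clsN. Qed.

Lemma cls_surj (x : calkin) : exists a, cls a = x.
Proof. by exists (repr x); exact: reprK. Qed.

Lemma cls_eq0 f : f \in finite_rank -> cls f = cls 0.
Proof. by move=> fF; apply/clsP; rewrite subr0. Qed.

Lemma cls_mul_congr a b a' b' : cls a = cls a' -> cls b = cls b' ->
  cls (a * b) = cls (a' * b').
Proof.
move=> /clsP aa /clsP bb; apply/clsP.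
rewrite -(subrK (a * b') (a * b)) -addrA -mulrBr -mulrBl.
by apply: rpredD; [exact: finite_rankMl | exact: finite_rankMr].
Qed.

Definition calkin_mul (x y : calkin) : calkin := cls (repr x * repr y).

Lemma cls_mulE a b : cls (a * b) = calkin_mul (cls a) (cls b).
Proof. by apply: cls_mul_congr; rewrite /cls reprK. Qed.

Fact calkin_mulA : associative calkin_mul.
Proof.
move=> x y z; have [a <-] := cls_surj x; have [b <-] := cls_surj y.
have [c <-] := cls_surj z.
by rewrite -!cls_mulE mulrA.
Qed.
Fact calkin_mul1 : left_id (cls 1) calkin_mul.
Proof. by move=> x; have [a <-] := cls_surj x; rewrite -cls_mulE mul1r. Qed.
Fact calkin_mulr1 : right_id (cls 1) calkin_mul.
Proof. by move=> x; have [a <-] := cls_surj x; rewrite -cls_mulE mulr1. Qed.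
Fact calkin_mulDl : left_distributive calkin_mul +%R.
Proof.
move=> x y z; have [a <-] := cls_surj x; have [b <-] := cls_surj y.
have [c <-] := cls_surj z.
by rewrite -!cls_mulE -!clsD -!cls_mulE mulrDl.
Qed.
Fact calkin_mulDr : right_distributive calkin_mul +%R.
Proof.
move=> x y z; have [a <-] := cls_surj x; have [b <-] := cls_surj y.
have [c <-] := cls_surj z.
by rewrite -!cls_mulE -!clsD -!cls_mulE mulrDr.
Qed.
HB.instance Definition _ := GRing.Zmodule_isPzRing.Build calkin
  calkin_mulA calkin_mul1 calkin_mulr1 calkin_mulDl calkin_mulDr.

Fact cls_zmod_morphism : zmod_morphism cls.
Proof. exact: clsB. Qed.
HB.instance Definition _ :=
  GRing.isZmodMorphism.Build (endo V) calkin cls cls_zmod_morphism.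
Fact cls_monoid_morphism : monoid_morphism cls.
Proof. by split=> // a b; exact: cls_mulE. Qed.
HB.instance Definition _ :=
  GRing.isMonoidMorphism.Build (endo V) calkin cls cls_monoid_morphism.

Lemma clsM a b : cls (a * b) = cls a * cls b. Proof. exact: rmorphM. Qed.
Lemma cls1 : cls 1 = 1. Proof. exact: rmorph1. Qed.
Lemma clsX a n : cls (a ^+ n) = cls a ^+ n. Proof. exact: rmorphXn. Qed.
Lemma cls_finite_rank f : f \in finite_rank -> cls f = 0.
Proof. by move=> fF; rewrite -(raddf0 cls) cls_eq0. Qed.

End Calkin.
Arguments calkin {F} V.

Section WeylOperators.
Context {F : fieldType} {V : lmodType F}.
Implicit Types a b f g u v s p : endo V.

(** Fredholm of index zero, in a form for which products, quotients and
    finite-rank changes are immediate; [weyl_mod_has_dim] and [weyl_bounded] relate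
    it to dimensions. *)
Definition weyl_mod a : Prop :=
  exists u v, [/\ u * v = 1, v * u = 1 & cls a = cls u].

Lemma weyl_modM a b : weyl_mod a -> weyl_mod b -> weyl_mod (a * b).
Proof.
move=> [u [v [uv vu au]]] [u' [v' [uv' vu' bu]]]; exists (u * u'), (v' * v); split.
- by rewrite mulrA -(mulrA u) uv' mulr1.
- by rewrite mulrA -(mulrA v') vu mulr1.
- by rewrite !clsM au bu.
Qed.

Lemma weyl_mod_inv u v : u * v = 1 -> v * u = 1 -> weyl_mod u.
Proof. by move=> uv vu; exists u, v. Qed.

Lemma weyl_mod_congr a b : cls a = cls b -> weyl_mod a -> weyl_mod b.
Proof. by move=> ab [u [v [uv vu au]]]; exists u, v; rewrite -ab. Qed.

Lemma weyl_modX a k : weyl_mod a -> weyl_mod (a ^+ k).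
Proof.
move=> wa; elim: k => [|k IHk]; last by rewrite exprS; exact: weyl_modM.
by apply: (@weyl_mod_inv _ 1); rewrite expr0 mulr1.
Qed.

Lemma weyl_mod_divr a b : weyl_mod (a * b) -> weyl_mod b -> weyl_mod a.
Proof.
move=> wab [u [v [uv vu bu]]].
suff : weyl_mod (a * b * v).
  by apply: weyl_mod_congr; rewrite !clsM bu -!clsM -mulrA uv mulr1.
by apply: weyl_modM => //; exact: weyl_mod_inv vu uv.
Qed.

Lemma weyl_mod_divl a b : weyl_mod (a * b) -> weyl_mod a -> weyl_mod b.
Proof.
move=> wab [u [v [uv vu au]]].
suff : weyl_mod (v * (a * b)).
  by apply: weyl_mod_congr; rewrite !clsM au -!clsM mulrA vu mul1r.
by apply: weyl_modM => //; exact: weyl_mod_inv vu uv.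
Qed.

(** Write [f x] as the combination of [v] with coefficient row [phi x], and let
    [P] be the matrix of the [phi (v j)]. Then [phi] identifies the null space of
    [1 - f] with the left kernel of [1 - P], and the quotient by its range with
    the quotient by the row space of [1 - P]; these have the same dimension. *)
Lemma one_sub_finite_rank_has_dim f : f \in finite_rank ->
  exists n, has_dim (null_space (1 - f)) n /\ has_codim (range (1 - f)) n.
Proof.
move=> /finite_rank_coord[m [v [phi [phil fE]]]].
pose rv (c : 'rV[F]_m) := lincomb (c ord0) v.
pose phiL : {linear V -> 'rV[F]_m} := HB.pack phi (GRing.isLinear.Build _ _ _ _ phi phil).
have phiD x y : phi (x + y) = phi x + phi y by exact: (linearD phiL).
have phiB x y : phi (x - y) = phi x - phi y by exact: (linearB phiL).
have phi0 : phi 0 = 0 by exact: (linear0 phiL).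
have phi_lc n c (b : 'I_n -> V) : phi (lincomb c b) = \sum_i c i *: phi (b i).
  by rewrite -[LHS]/(phiL _) linear_sum; apply: eq_bigr => i _; rewrite linearZ.
pose P : 'M[F]_m := \matrix_j phi (v j).
pose M := 1%:M - P.
have phi_rv c : phi (rv c) = c *m P.
  by rewrite phi_lc mulmx_sum_row; apply: eq_bigr => i _; rewrite rowK.
have rvB c d : rv (c - d) = rv c - rv d.
  by rewrite /rv -lincombB; apply: eq_lincomb => i; rewrite !mxE.
have rvD c d : rv (c + d) = rv c + rv d.
  by rewrite /rv -lincombD; apply: eq_lincomb => i; rewrite !mxE.
have fE' x : f x = rv (phi x) by rewrite fE.
have rvM c : rv (c *m M) = (1 - f) (rv c).
  by rewrite mulmxBr mulmx1 rvB -phi_rv -fE'.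
have phiM x : phi ((1 - f) x) = phi x *m M.
  by rewrite !endoE phiB fE' phi_rv mulmxBr mulmx1.
have rv_mul n (A : 'M[F]_(n, m)) c :
    lincomb c (fun i => lincomb (A i) v) = rv ((\row_i c i) *m A).
  by rewrite /rv -lincomb_mulmx; apply: eq_bigr => i _; rewrite mxE.
exists (\rank (kermx M)); split.
  pose B := row_base (kermx M).
  exists (fun i => lincomb (B i) v); split=> [i|x Nx|c lincomb0 i].
  - have BM : row i B *m M = 0.
      by apply/sub_kermxP; rewrite (submx_trans (row_sub _ _)) // eq_row_base.
    rewrite (_ : lincomb _ _ = rv (row i B)); last first.
      by rewrite /rv; apply: eq_lincomb => j; rewrite [RHS]mxE.
    apply/null_spaceP; rewrite -rvM BM /rv /lincomb big1 // => j _.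
    by rewrite mxE scale0r.
  - have xE : x = rv (phi x).
      by move/null_spaceP: Nx; rewrite !endoE fE' => /eqP; rewrite subr_eq0 => /eqP.
    have : (phi x <= B)%MS.
      rewrite eq_row_base; apply/sub_kermxP; rewrite -phiM.
      by move/null_spaceP: Nx => ->; exact: phi0.
    move=> /submxP[d dE]; exists (d ord0); rewrite -/(lincomb _ _) rv_mul.
    rewrite {1}xE dE; apply/eqP; rewrite subr_eq0; apply/eqP; congr (rv (_ *m _)).
    by apply/rowP => j; rewrite mxE.
  - have := lincomb0; rewrite -/(lincomb _ _) rv_mul /=.
    set y := _ *m B => rvy0.
    have yM : y *m M = 0.
      by rewrite /y -mulmxA (_ : B *m M = 0) ?mulmx0 //; apply/sub_kermxP;
        rewrite eq_row_base.
    have y0 : y = 0.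
      move: yM; rewrite mulmxBr mulmx1 -phi_rv rvy0 => /eqP.
      by rewrite phi0 subr0 => /eqP.
    have : (\row_i c i) = 0.
      by apply: (row_free_inj (row_base_free (kermx M))); rewrite -/B -/y y0 mul0mx.
    by move=> /rowP/(_ i); rewrite !mxE.
have -> : \rank (kermx M) = \rank (M^C)%MS by rewrite mxrank_ker mxrank_compl.
pose B := row_base (M^C)%MS.
exists (fun i => lincomb (B i) v); split=> // [x _|c [y _ yE] i].
  have : (phi x <= B + M)%MS.
    apply: submx_full; have := addsmx_compl_full M.
    by rewrite -!sub1mx => /submx_trans; apply; rewrite addsmxC addsmxS // eq_row_base.
  move=> /sub_addsmxP[[d e] /= de]; exists (d ord0); rewrite -/(lincomb _ _) rv_mul.
  exists (x + rv e) => //;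
    rewrite -[LHS]/((1 - f) (x + rv e)) [LHS]appD -rvM endoBE endo1E fE' de.
  rewrite rvD opprD addrA addrNK; congr (_ - rv (_ *m _)).
  by apply/rowP => j; rewrite mxE.
move: yE; rewrite -/(lincomb _ _) rv_mul; set z := _ *m B => yE.
have zM : (z <= M)%MS.
  have -> : z = (z + phi y) *m M.
    by rewrite mulmxDl -phiM yE phi_rv mulmxBr mulmx1 subrK.
  exact: submxMl.
have z0 : z = 0.
  apply/eqP; rewrite -submx0 -(capmx_compl M) sub_capmx zM /=.
  by rewrite (submx_trans (submxMl _ _)) // eq_row_base.
have : (\row_i c i) = 0.
  by apply: (row_free_inj (row_base_free (M^C)%MS)); rewrite -/B -/z z0 mul0mx.
by move=> /rowP/(_ i); rewrite !mxE.
Qed.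

Lemma weyl_mod_has_dim a : weyl_mod a ->
  exists n, has_dim (null_space a) n /\ has_codim (range a) n.
Proof.
move=> [u [v [uv vu /esym/clsP fF]]]; pose f := v * (u - a).
have fE : 1 - f = v * a by rewrite /f mulrBr vu opprB addrC subrK.
have aE : a = u * (1 - f) by rewrite fE mulrA uv mul1r.
have [n [[b [Nb sb ib]] [d [_ sd id]]]] := one_sub_finite_rank_has_dim (finite_rankMl v fF).
have uK x : v (u x) = x by rewrite -endoME vu.
have uI x y : u x = u y -> x = y by move=> /(congr1 v); rewrite !uK.
have NE : null_space (1 - f) = null_space a.
  apply/seteqP; split=> x /null_spaceP Nx; apply/null_spaceP.
    by rewrite aE endoME Nx app0.
  by apply: uI; rewrite app0 -endoME -aE.
exists n; split; first by exists b; rewrite -NE.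
exists (u \o d); split=> // [x _|c].
  have [c [y _ yE]] := sd (v x) I; exists c; exists y => //.
  by rewrite aE endoME yE appB -/(lincomb _ _) app_lincomb -(endoME u v) uv.
rewrite -/(lincomb _ _) -app_lincomb => -[y _]; rewrite {1}aE endoME => /uI yE.
by apply: id; exists y.
Qed.

Lemma weyl_mod_weyl a : weyl_mod a -> weyl a.
Proof.
move=> /weyl_mod_has_dim[n [dn cn]].
have fN : finite_dim (null_space a) by exists n.
have fR : finite_codim (range a) by exists n.
split=> //; rewrite /fredholm_index.
rewrite (has_dim_uniq (has_dimP fN) dn).
by rewrite (has_codim_uniq (subspace_range a) (has_codimP fR) cn) subrr.
Qed.

Lemma weyl_has_dim a : weyl a ->
  exists n, has_dim (null_space a) n /\ has_codim (range a) n.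
Proof.
move=> [[fN fR] /eqP]; rewrite subr_eq0 => /eqP[e].
exists (Defs.dim (null_space a)); split; first exact: has_dimP.
by rewrite e; exact: has_codimP.
Qed.

End WeylOperators.

(** * Ascent and descent *)

Section AscentDescent.
Context {F : fieldType} {V : lmodType F}.
Implicit Types a b u v : endo V.

Definition finite_ascent a : Prop :=
  exists p, forall x, (a ^+ p.+1) x = 0 -> (a ^+ p) x = 0.
Definition finite_descent a : Prop :=
  exists q, forall x, exists y, (a ^+ q) x = (a ^+ q.+1) y.

Lemma nat_infP (A : set nat) : nat_inf A <> None <-> exists n, A n.
Proof.
rewrite /nat_inf; case: pselect => [eA|neA]; split=> //.
  by move=> _; have [n /asboolP An] := eA; exists n.
by move=> [n An]; exfalso; apply: neA; exists n; exact/asboolP.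
Qed.

Lemma iter_endo a n : iter n a = a ^+ n :> (V -> V).
Proof. by apply/funext => x; rewrite endoXE. Qed.

Lemma null_space_expS a p :
  null_space (iter p a) = null_space (iter p.+1 a) <->
  forall x, (a ^+ p.+1) x = 0 -> (a ^+ p) x = 0.
Proof.
rewrite !iter_endo; split=> [e x ax|ap].
  by have : null_space (a ^+ p) x by rewrite e.
apply/seteqP; split=> x /null_spaceP; last by move/ap.
by move=> ax; apply/null_spaceP; rewrite exprS endoME ax app0.
Qed.

Lemma ascentP a : ascent a <> None <-> finite_ascent a.
Proof.
rewrite nat_infP; split=> -[p ap]; exists p; first exact/null_space_expS.
exact/(null_space_expS a p).
Qed.

Lemma descentP a : descent a <> None <-> finite_descent a.
Proof.
rewrite nat_infP; split=> -[q aq]; exists q.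
  move=> x; have : range (iter q.+1 a) ((a ^+ q) x).
    by rewrite -aq iter_endo; exists x.
  by rewrite iter_endo => -[y _ <-]; exists y.
rewrite /= -/(iter q.+1 a) !iter_endo; apply/seteqP; split=> _ [x _ <-].
  by have [y ->] := aq x; exists y.
by exists (a x) => //; rewrite exprSr.
Qed.

Lemma ascent_stable a p k x :
  (forall y, (a ^+ p.+1) y = 0 -> (a ^+ p) y = 0) ->
  (a ^+ (p + k)) x = 0 -> (a ^+ p) x = 0.
Proof.
move=> ap; elim: k x => [|k IHk] x; first by rewrite addn0.
by rewrite addnS exprSr endoME => /IHk; rewrite -endoME -exprSr; exact: ap.
Qed.

Lemma descent_stable a q k x :
  (forall x, exists y, (a ^+ q) x = (a ^+ q.+1) y) ->
  exists y, (a ^+ q) x = (a ^+ (q + k)) y.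
Proof.
move=> aq; elim: k x => [|k IHk] x; first by exists x; rewrite addn0.
have [y ->] := IHk x; have [z yz] := aq y; exists z.
by rewrite addnC exprD endoME yz -endoME -exprD addnS addnS addnC.
Qed.

(** The range of a high power meets its null space trivially. *)
Lemma finite_ascent_large a k : finite_ascent a -> exists p, (k <= p)%N /\
  forall x, (a ^+ p) ((a ^+ p) x) = 0 -> (a ^+ p) x = 0.
Proof.
move=> [p ap]; exists (p + k)%N; split; first exact: leq_addl.
move=> x; rewrite -endoME -exprD -addnA => /(ascent_stable ap) ax.
by rewrite addnC exprD endoME ax app0.
Qed.

Definition browder a : Prop :=
  [/\ finite_ascent a, finite_descent a & finite_dim (null_space a)].

(** The spectral projection [q] onto the null space of [a ^ k], along its range.
    The map [a + q] is invertible because [a] is bijective on the range and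
    nilpotent, so that [a + 1] is invertible, on the null space. *)
Lemma browder_projection a : browder a ->
  exists k (q : endo V), [/\ [/\ forall x, q ((a ^+ k) x) = 0, forall y, (a ^+ k) (q y) = 0,
                   forall z, (a ^+ k) z = 0 -> q z = z
                 & forall y, exists x, y = (a ^+ k) x + q y],
    q \in finite_rank, forall c, a * c = c * a -> q * c = c * q
  & exists v, (a + q) * v = 1 /\ v * (a + q) = 1].
Proof.
move=> [fa [q0 aq0] fN].
have [k [k1 inj]] := finite_ascent_large q0.+1 fa.
have q0k := ltnW k1.
have sur x : exists y, (a ^+ k) x = (a ^+ k) (a ((a ^+ k) y)).
  have [y xy] := descent_stable k.+1 x aq0; exists y.
  have -> : (a ^+ k) (a ((a ^+ k) y)) = (a ^+ (k - q0 + (q0 + k.+1))) y.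
    by rewrite -!endoME -exprSr -exprD addnA subnK // addSnnS.
  have -> : (a ^+ k) x = (a ^+ (k - q0 + q0)) x by rewrite subnK.
  by rewrite exprD [in RHS]exprD !endoME xy.
have uniq z x : (a ^+ k) z = 0 -> z = (a ^+ k) x -> z = 0.
  by move=> + zx; rewrite zx; exact: inj.
have /choice[g gP] y : exists x, (a ^+ k) (y - (a ^+ k) x) = 0.
  have [x yx] := sur y; exists (a x).
  rewrite appB yx -[(a ^+ k) (a x)]endoME -exprSr exprS endoME.
  by rewrite subrr.
pose qf y := y - (a ^+ k) (g y).
have qE y z : (a ^+ k) z = 0 -> (exists x, y = (a ^+ k) x + z) -> qf y = z.
  move=> az [x yE]; apply/eqP; rewrite -subr_eq0; apply/eqP.
  apply: (uniq _ (x - g y)); first by rewrite appB gP az subrr.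
  by rewrite /qf {1}yE addrAC addrK appB.
have ql : linear qf.
  move=> t x y; apply: qE; first by rewrite appD appZ !gP scaler0 addr0.
  by exists (t *: g x + g y); rewrite appD appZ /qf scalerBr addrACA;
     congr (_ + _); rewrite [RHS]addrC subrK.
pose q := Endo ql.
have q1 x : q ((a ^+ k) x) = 0.
  by apply: qE; [exact: app0 | exists x; rewrite addr0].
have q2 y : (a ^+ k) (q y) = 0 by exact: gP.
have q3 z : (a ^+ k) z = 0 -> q z = z.
  by move=> az; apply: qE => //; exists 0; rewrite app0 add0r.
have q4 y : exists x, y = (a ^+ k) x + q y.
  by exists (g y); rewrite /= /qf addrC subrK.
have qF : q \in finite_rank.
  have /finite_dimP[n [b [_ sp]]] := finite_dim_nullX k fN.
  by apply: (finite_rank_span (v := b)) => y; exact: sp.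
have qC c : a * c = c * a -> q * c = c * q.
  move=> ac; have akc : GRing.comm (a ^+ k) c.
    by apply: commr_sym; apply: commrX; exact: esym.
  apply: endoP => y; rewrite !endoME; apply: qE.
    by rewrite -endoME akc endoME q2 app0.
  by have [x yE] := q4 y; exists (c x); rewrite {1}yE appD -!endoME akc.
exists k, q; split=> //; apply: bij_invertible => [x|y].
  rewrite endoDE => ax.
  have aq : q * a = a * q by exact: qC.
  have qx0 : a (q x) = - q x.
    have /(congr1 q) := ax; rewrite appD app0 (q3 (q x)) // -endoME aq endoME.
    by move/eqP; rewrite addr_eq0 => /eqP.
  have qx : q x = 0.
    have : (a ^+ k) (q x) = (-1) ^+ k *: q x.
      elim: (k) => [|n IHn]; first by rewrite expr0 scale1r.
      by rewrite exprSr endoME qx0 appN IHn exprS mulN1r scaleNr.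
    rewrite q2 => /esym/eqP; rewrite scaler_eq0 => /orP[|/eqP//].
    by rewrite signr_eq0.
  move: ax; rewrite qx addr0 => ax; rewrite -qx q3 //.
  by rewrite -(prednK (leq_ltn_trans (leq0n _) k1)) exprSr endoME ax app0.
have [x yE] := q4 y; have [w xw] := sur x.
(* On the null space of [a ^ k], the finite geometric series inverts [a + 1]. *)
pose s := \sum_(i < k) (- a) ^+ i.
have sE : (a + 1) * s = 1 - (- a) ^+ k.
  by rewrite -opprB subrX1 -mulNr opprB opprK addrC.
have ss : GRing.comm (a ^+ k) s.
  apply: commr_sum => i _; apply: commrX; apply: commr_sym; apply: commrX.
  by apply: commr_sym; apply: commrN.
exists ((a ^+ k) ((a ^+ k) w) + s (q y)).
rewrite appD !endoDE q1 addr0 -[a _]endoME -exprS exprSr endoME -xw [q (s _)]q3; last first.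
  by rewrite -endoME ss endoME q2 app0.
have -> : a (s (q y)) + s (q y) = ((a + 1) * s) (q y) by [].
rewrite sE endoBE endo1E exprNn endoME q2 app0 subr0.
by rewrite -yE.
Qed.

Lemma browder_weyl_mod a : browder a -> weyl_mod a.
Proof.
move=> /browder_projection[k [q [_ qF _ [v [aqv vaq]]]]].
by exists (a + q), v; split=> //; rewrite clsD (cls_finite_rank qF) addr0.
Qed.

(** Index zero makes the null space of [a ^ p] as large as a complement of its
    range; when the two meet trivially they are complements of each other, and
    the range of [a ^ p] is that of its square. *)
Lemma weyl_mod_browder a : weyl_mod a -> finite_ascent a -> browder a.
Proof.
move=> wa fa; split=> //; last first.
  by have [n [dn _]] := weyl_mod_has_dim wa; exists n.
have [p [p1 inj]] := finite_ascent_large 1 fa.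
have [n [[b [Nb _ ib]] [d qd]]] := weyl_mod_has_dim (weyl_modX p wa).
have sR := subspace_range (a ^+ p).
have [_ sp _] : quotient_basis (range (a ^+ p)) setT b.
  apply: (quotient_basis_indep sR qd) => // c [x _ xE].
  apply: ib; rewrite -/(lincomb c b) -xE; apply: inj; rewrite xE app_lincomb.
  by rewrite /lincomb big1 // => i _; rewrite /= (_ : (a ^+ p) (b i) = 0) ?scaler0 //;
    exact: Nb.
exists p => x; have [c [y _ yE]] := sp x I.
exists ((a ^+ p.-1) y); rewrite -endoME -exprD addSnnS prednK // exprD endoME yE.
rewrite appB app_lincomb /lincomb [X in _ - X]big1 ?subr0 // => i _.
by rewrite /= (_ : (a ^+ p) (b i) = 0) ?scaler0 //; exact: Nb.
Qed.

End AscentDescent.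

(** * Real-valued norm and completeness *)

Section RealNorm.
Context {K : realType}.

(** The norm takes values in the complex field, whose order is partial; its real
    part keeps all the information and makes real linear arithmetic available. *)
Definition nrm {V : normedZmodType K[i]} (x : V) : K := complex.Re `|x|.

Section NormedZmodule.
Context {V : normedZmodType K[i]}.
Implicit Types x y : V.

Lemma normE x : `|x| = (nrm x)%:C%C.
Proof. by rewrite /nrm RRe_real // ger0_real. Qed.

Lemma nrm_ge0 x : 0 <= nrm x.
Proof. by rewrite -(@lecR K) -normE normr_ge0. Qed.

Lemma nrm0 : nrm (0 : V) = 0.
Proof. by rewrite /nrm normr0. Qed.

Lemma nrm_eq0 x : (nrm x == 0) = (x == 0).
Proof.
apply/eqP/eqP => [n0|->]; last exact: nrm0.
by apply/eqP; rewrite -normr_eq0 normE n0.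
Qed.

Lemma nrm_gt0 x : (0 < nrm x) = (x != 0).
Proof. by rewrite lt_def nrm_ge0 andbT nrm_eq0. Qed.

Lemma nrmD x y : nrm (x + y) <= nrm x + nrm y.
Proof. by rewrite -lecR (rmorphD (real_complex K)) /= -!normE ler_normD. Qed.

Lemma nrmN x : nrm (- x) = nrm x.
Proof. by rewrite /nrm normrN. Qed.

Lemma nrmB x y : nrm (x - y) <= nrm x + nrm y.
Proof. by rewrite -(nrmN y) nrmD. Qed.

Lemma nrm_distC x y : nrm (x - y) = nrm (y - x).
Proof. by rewrite -nrmN opprB. Qed.

Lemma nrm_sum n (E : 'I_n -> V) : nrm (\sum_i E i) <= \sum_i nrm (E i).
Proof.
elim/big_ind2: _ => [|x1 x2 y1 y2 h1 h2|//]; first by rewrite nrm0.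
by rewrite (le_trans (nrmD _ _)) // lerD.
Qed.

End NormedZmodule.

Lemma nrmM (a b : K[i]) : nrm (a * b) = nrm a * nrm b.
Proof. by apply: (fmorph_inj (real_complex K)); rewrite /= rmorphM -!normE normrM. Qed.

Lemma nrm1 : nrm (1 : K[i]) = 1.
Proof. by rewrite /nrm normr1. Qed.

Lemma nrmR (r : K) : nrm (r%:C%C) = `|r|.
Proof. by rewrite /nrm normc_def /= expr0n addr0 sqrtr_sqr. Qed.

Lemma nrmV (a : K[i]) : nrm a^-1 = (nrm a)^-1.
Proof. by apply: (fmorph_inj (real_complex K)); rewrite /= fmorphV -!normE normfV. Qed.

Lemma nrmX (a : K[i]) n : nrm (a ^+ n) = nrm a ^+ n.
Proof. by elim: n => [|n IHn]; rewrite ?expr0 ?nrm1 // !exprS nrmM IHn. Qed.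

Lemma nrm_Re (a : K[i]) : `|complex.Re a| <= nrm a.
Proof. by rewrite -lecR -normE normc_ge_Re. Qed.

Context {X : normedModType K[i]}.

Lemma nrmZ (a : K[i]) (x : X) : nrm (a *: x) = nrm a * nrm x.
Proof. by apply: (fmorph_inj (real_complex K)); rewrite rmorphM /= -!normE normrZ. Qed.

Lemma ball_nrm (x y : X) (e : K) : ball x (e%:C%C) y <-> nrm (x - y) < e.
Proof. by rewrite -ball_normE /ball_ /= normE ltcR. Qed.

End RealNorm.

Section Completeness.
Context {K : realType} {X : completeNormedModType K[i]}.
Implicit Types x y : X.

Lemma gt0_complexE (e : K[i]) : 0 < e -> exists2 r : K, 0 < r & e = r%:C%C.
Proof.
case: e => a b; rewrite ltcE /= => /andP[/eqP -> a0]; by exists a.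
Qed.

Lemma geometric_tail (u : nat -> X) (C : K) :
  (forall n, nrm (u n.+1 - u n) <= C * 2^-1 ^+ n) ->
  forall n k, nrm (u (n + k)%N - u n) <= 2 * C * 2^-1 ^+ n.
Proof.
move=> uC n k; have C0 : 0 <= C.
  by have := uC 0%N; rewrite expr0 mulr1; exact: le_trans (nrm_ge0 _).
suff : nrm (u (n + k)%N - u n) <= 2 * C * 2^-1 ^+ n - 2 * C * 2^-1 ^+ (n + k).
  move=> /le_trans; apply; rewrite lerBlDr lerDl.
  by rewrite mulr_ge0 ?mulr_ge0 // exprn_ge0 // invr_ge0.
elim: k => [|k IHk]; first by rewrite addn0 !subrr nrm0.
rewrite addnS -(subrK (u (n + k)%N) (u _)) -addrA (le_trans (nrmD _ _)) //.
apply: le_trans (lerD (uC _) IHk) _; rewrite exprS.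
set z := _ ^+ (n + k); set w := _ ^+ n; by lra.
Qed.

Lemma pow_small (C z e : K) : 0 <= z < 1 -> 0 < e ->
  exists N, forall n, (N <= n)%N -> C * z ^+ n < e.
Proof.
move=> /andP[z0 z1] e0.
have /(cvg_geometric C)/cvgrPdist_lt : `|z| < 1 by rewrite ger0_norm.
move=> /(_ e e0)[N _ NP]; exists N => n Nn.
have := NP n Nn; rewrite /geometric /= sub0r normrN.
by apply: le_lt_trans; exact: ler_norm.
Qed.

Lemma half_pow_small (C e : K) : 0 < e ->
  exists N, forall n, (N <= n)%N -> C * 2^-1 ^+ n < e.
Proof. by move=> e0; apply: pow_small => //; apply/andP; split; lra. Qed.

(** The form in which completeness is used: the Baire argument, the Neumann
    series and the open mapping theorem all converge geometrically. *)
Lemma geometric_limit (u : nat -> X) (C : K) :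
  (forall n, nrm (u n.+1 - u n) <= C * 2^-1 ^+ n) ->
  exists l, forall n, nrm (l - u n) <= 2 * C * 2^-1 ^+ n.
Proof.
move=> uC; have tail := geometric_tail uC.
have cu : cvg (u @ \oo).
  apply: cauchy_cvg; apply: cauchy_exP => e /gt0_complexE[r r0 ->].
  have [N NP] := half_pow_small (2 * C) r0.
  exists (u N); exists N => // n Nn; apply/ball_nrm.
  rewrite nrm_distC -(subnKC Nn); exact: le_lt_trans (tail _ _) (NP N (leqnn N)).
exists (lim (u @ \oo)) => n; apply/ler_addgt0Pr => e e0.
have e0' : 0 < e%:C%C :> K[i] by rewrite ltcR.
have /cvgrPdist_lt/(_ _ e0')[N _ NP] := cu.
have := NP (n + N)%N (leq_addl _ _); rewrite normE ltcR => h.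
rewrite -(subrK (u (n + N)%N) (lim _)) -addrA (le_trans (nrmD _ _)) //.
by rewrite [leRHS]addrC; apply: lerD; [exact: ltW | exact: tail].
Qed.

End Completeness.

Section ScalarCompleteness.
Context {K : realType}.

Lemma nrmi : nrm ('i%C : K[i]) = 1.
Proof. by rewrite /nrm normc_def /= expr0n expr1n add0r sqrtr1. Qed.

Lemma nrm_Im (a : K[i]) : `|complex.Im a| <= nrm a.
Proof.
rewrite -[X in `|X|]opprK normrN -ReiNIm (le_trans (nrm_Re _)) //.
by rewrite nrmM nrmi mulr1.
Qed.

Lemma nrm_ReIm (a : K[i]) : nrm a <= `|complex.Re a| + `|complex.Im a|.
Proof.
rewrite {1}(complexE a) (le_trans (nrmD _ _)) //.
by rewrite nrmM nrmi mul1r !nrmR.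
Qed.

(** The limit is the supremum of the lower ends of nested intervals. *)
Lemma real_geometric_limit (u : nat -> K) (C : K) :
  (forall n, `|u n.+1 - u n| <= C * 2^-1 ^+ n) ->
  exists l, forall n, `|l - u n| <= 2 * C * 2^-1 ^+ n.
Proof.
move=> uC; pose e n := 2 * C * 2^-1 ^+ n.
have step n : `|u n.+1 - u n| <= e n - e n.+1.
  rewrite (le_trans (uC n)) // /e exprS; set z := _ ^+ n; lra.
have up n k : u n - e n <= u (n + k)%N - e (n + k)%N.
  elim: k => [|k IHk]; first by rewrite addn0.
  rewrite (le_trans IHk) // addnS; have := step (n + k)%N.
  by rewrite ler_norml => /andP[h _]; lra.
have dn n k : u (n + k)%N + e (n + k)%N <= u n + e n.
  elim: k => [|k IHk]; first by rewrite addn0.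
  apply: le_trans IHk; rewrite addnS; have := step (n + k)%N.
  by rewrite ler_norml => /andP[_ h]; lra.
have e0 n : 0 <= e n.
  have C0 : 0 <= C by have := uC 0%N; rewrite expr0 mulr1; exact: le_trans.
  by rewrite /e mulr_ge0 ?mulr_ge0 // exprn_ge0 // invr_ge0.
have le_all n m : u n - e n <= u m + e m.
  apply: le_trans (up n m) _; rewrite addnC; apply: le_trans _ (dn m n).
  by have := e0 (m + n)%N; lra.
pose A := [set x : K | exists n, x = u n - e n].
exists (sup A) => n.
have h1 : u n - e n <= sup A.
  apply: ub_le_sup; last by exists n.
  by exists (u 0%N + e 0%N) => _ [m ->].
have h2 : sup A <= u n + e n.
  by apply: ge_sup => [|_ [m ->]//]; exists (u 0%N - e 0%N); exists 0%N.
by rewrite ler_norml -/(e n); apply/andP; split; lra.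
Qed.

Lemma complex_geometric_limit (u : nat -> K[i]) (C : K) :
  (forall n, nrm (u n.+1 - u n) <= C * 2^-1 ^+ n) ->
  exists l, forall n, nrm (l - u n) <= 4 * C * 2^-1 ^+ n.
Proof.
move=> uC.
have [n|x xP] := @real_geometric_limit (fun n => complex.Re (u n)) C.
  rewrite -(raddfB (@complex.Re K : Rcomplex K -> K)).
  exact: le_trans (nrm_Re _) (uC n).
have [n|y yP] := @real_geometric_limit (fun n => complex.Im (u n)) C.
  rewrite -(raddfB (@complex.Im K : Rcomplex K -> K)).
  exact: le_trans (nrm_Im _) (uC n).
exists (Complex x y) => n; rewrite (le_trans (nrm_ReIm _)) //.
have -> : complex.Re (Complex x y - u n) = x - complex.Re (u n) by case: (u n).
have -> : complex.Im (Complex x y - u n) = y - complex.Im (u n) by case: (u n).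
rewrite (le_trans (lerD (xP n) (yP n))) //.
by set z := _ ^+ n; lra.
Qed.

End ScalarCompleteness.

Section BoundedOperators.
Context {K : realType} {X : completeNormedModType K[i]}.
Implicit Types (x y : X) (a b g : endo X) (c d : K).

Definition op_norm_le a c : Prop := 0 <= c /\ forall x, nrm (a x) <= c * nrm x.
Definition bounded a : Prop := exists c, op_norm_le a c.

Lemma op_norm_le_weaken a c d : c <= d -> op_norm_le a c -> op_norm_le a d.
Proof.
move=> cd [c0 ac]; split=> [|x]; first exact: le_trans cd.
by rewrite (le_trans (ac x)) // ler_wpM2r ?nrm_ge0.
Qed.

Lemma op_norm_leD a b c d : op_norm_le a c -> op_norm_le b d -> op_norm_le (a + b) (c + d).
Proof.
move=> [c0 ac] [d0 bd]; split=> [|x]; first exact: addr_ge0.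
by rewrite mulrDl (le_trans (nrmD _ _)) // lerD.
Qed.

Lemma op_norm_leN a c : op_norm_le a c -> op_norm_le (- a) c.
Proof. by move=> [c0 ac]; split=> // x; rewrite nrmN. Qed.

Lemma op_norm_leM a b c d : op_norm_le a c -> op_norm_le b d -> op_norm_le (a * b) (c * d).
Proof.
move=> [c0 ac] [d0 bd]; split=> [|x]; first exact: mulr_ge0.
by rewrite (le_trans (ac _)) // -mulrA ler_wpM2l.
Qed.

Lemma op_norm_le1 : op_norm_le 1 1.
Proof. by split=> // x; rewrite mul1r. Qed.

Lemma op_norm_le0 : op_norm_le 0 0.
Proof. by split=> // x; rewrite mul0r nrm0. Qed.

Lemma op_norm_le_scal (z : K[i]) : op_norm_le (scal z) (nrm z).
Proof. by split=> [|x]; [exact: nrm_ge0 | rewrite scalE nrmZ]. Qed.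

Lemma op_norm_leX a c n : op_norm_le a c -> op_norm_le (a ^+ n) (c ^+ n).
Proof.
move=> ac; elim: n => [|n IHn]; first exact: op_norm_le1.
by rewrite !exprS; exact: op_norm_leM.
Qed.

Lemma boundedD a b : bounded a -> bounded b -> bounded (a + b).
Proof. by move=> [c ac] [d bd]; exists (c + d); exact: op_norm_leD. Qed.
Lemma boundedN a : bounded a -> bounded (- a).
Proof. by move=> [c ac]; exists c; exact: op_norm_leN. Qed.
Lemma boundedB a b : bounded a -> bounded b -> bounded (a - b).
Proof. by move=> ba bb; apply: boundedD => //; exact: boundedN. Qed.
Lemma boundedM a b : bounded a -> bounded b -> bounded (a * b).
Proof. by move=> [c ac] [d bd]; exists (c * d); exact: op_norm_leM. Qed.
Lemma bounded1 : bounded 1. Proof. by exists 1; exact: op_norm_le1. Qed.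
Lemma bounded_scal z : bounded (scal z).
Proof. by exists (nrm z); exact: op_norm_le_scal. Qed.
Lemma boundedX a n : bounded a -> bounded (a ^+ n).
Proof. by move=> [c ac]; exists (c ^+ n); exact: op_norm_leX. Qed.

Lemma bounded_sum n (E : 'I_n -> endo X) :
  (forall i, bounded (E i)) -> bounded (\sum_(i < n) E i).
Proof.
by move=> bE; elim/big_ind: _ => //; [exists 0; exact: op_norm_le0 | exact: boundedD].
Qed.

Lemma half_pow_eq0 x C : (forall n, nrm x <= C * 2^-1 ^+ n) -> x = 0.
Proof.
move=> xC; apply/eqP; rewrite -nrm_eq0 eq_le nrm_ge0 andbT.
apply/ler_addgt0Pr => e /(half_pow_small C)[N NP]; rewrite add0r ltW //.
exact: le_lt_trans (xC N) (NP N (leqnn N)).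
Qed.

(** The bound [2^-1] is a convenience: it makes the series converge at the rate
    that [geometric_limit] expects. *)
Lemma neumann a c : op_norm_le a c -> c <= 2^-1 ->
  exists g, [/\ (1 - a) * g = 1, g * (1 - a) = 1, op_norm_le g 2
    & op_norm_le (g - 1) (2 * c)].
Proof.
move=> [c0 ac] c2.
have ah x : nrm (a x) <= 2^-1 * nrm x.
  by rewrite (le_trans (ac x)) // ler_wpM2r ?nrm_ge0.
have [x|y|g [ag ga]] := @bij_invertible _ _ (1 - a).
- rewrite !endoE => /eqP; rewrite subr_eq0 => /eqP xa; apply/eqP; rewrite -nrm_eq0.
  by have := ah x; have := nrm_ge0 x; rewrite -xa; lra.
- pose u n := iter n (fun x => y + a x) 0.
  have uS n : u n.+1 = y + a (u n) by [].
  have [n|l lP] := @geometric_limit _ _ u (nrm y).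
    elim: n => [|n IHn]; first by rewrite /u /= app0 addr0 subr0 expr0 mulr1.
    rewrite [u n.+2]uS {2}uS opprD addrACA subrr add0r -appB (le_trans (ah _)) //.
    by rewrite exprS; move: IHn; set z := _ ^+ n; set w := nrm (_ - _); lra.
  exists l; apply/eqP; rewrite -subr_eq0; apply/eqP.
  apply: (@half_pow_eq0 _ (2 * nrm y)) => n.
  have -> : (1 - a) l - y = (l - u n.+1) - a (l - u n).
    rewrite uS !endoE appB opprB opprD -[RHS]addrA.
    by rewrite [X in _ = _ + X]addrA subrK addrA addrAC.
  rewrite (le_trans (nrmB _ _)) //.
  have := lP n.+1; have := ah (l - u n); have := lP n; rewrite exprS.
  set z := _ ^+ n; set w1 := nrm (_ - _); set w2 := nrm (_ - _); lra.
exists g.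
have gE y : g y = y + a (g y).
  by have := congr1 (fun b : endo X => b y) ag; rewrite !endoE => {2}<-; rewrite subrK.
have g2 : op_norm_le g 2.
  split=> // y; have := ah (g y); have := nrmD y (a (g y)).
  by rewrite -gE; lra.
split=> //; have -> : g - 1 = a * g.
  by apply: endoP => y; rewrite !endoE {1}gE addrAC subrr add0r.
by rewrite [2 * c]mulrC; apply: op_norm_leM.
Qed.

End BoundedOperators.

(** * The open mapping theorem *)

Section OpenMapping.
Context {K : realType} {X : completeNormedModType K[i]}.
Implicit Types (x y z : X) (r s t C : K).

(** Otherwise every ball contains a point at positive distance from [D n]; nested
    balls avoiding each [D n] in turn shrink to a point that no [D n] contains. *)
Lemma baire_somewhere_dense (D : nat -> set X) :
  (forall y, exists N, forall n, (N <= n)%N -> D n y) ->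
  exists n y0 (rho : K), 0 < rho /\ forall y, nrm (y - y0) < rho ->
    forall e : K, 0 < e -> exists2 z, D n z & nrm (y - z) < e.
Proof.
move=> cov; apply: contrapT => nd.
have step (s : nat * (X * K)) : exists s' : X * K, 0 < s.2.2 ->
    [/\ 0 < s'.2, s'.2 <= s.2.2 * 2^-1, nrm (s'.1 - s.2.1) <= s.2.2 * 2^-1
      & forall z, D s.1 z -> 2 * s'.2 <= nrm (s'.1 - z)].
  case: s => n [y0 rho] /=; have [rho0|rho0] := ltP 0 rho; last first.
    by exists (0, 0).
  apply: contrapT => ns; apply: nd; exists n, y0, (rho * 2^-1).
  split=> [|y yy0 e e0]; first by rewrite mulr_gt0 ?invr_gt0.
  apply: contrapT => nz; apply: ns.
  exists (y, Num.min (rho * 2^-1) (e * 2^-1)) => _ /=; split.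
  - by rewrite lt_min !mulr_gt0 ?invr_gt0.
  - by rewrite ge_min lexx.
  - exact: ltW.
  - move=> z Dz; have [//|yz] := leP (2 * Num.min (rho * 2^-1) (e * 2^-1)) (nrm (y - z)).
    exfalso; apply: nz; exists z => //; apply: lt_le_trans yz _.
    have : Num.min (rho * 2^-1) (e * 2^-1) <= e * 2^-1 by rewrite ge_min lexx orbT.
    lra.
have [f fP] := choice step.
pose u := fix u n := if n is m.+1 then f (m, u m) else (0, 1).
pose y n := (u n).1; pose rho n := (u n).2.
have rho0 n : 0 < rho n.
  elim: n => [|n IHn]; first by rewrite /rho /=.
  by have [] := fP (n, u n) IHn.
have rhoS n : rho n.+1 <= rho n * 2^-1 by have [] := fP (n, u n) (rho0 n).
have yS n : nrm (y n.+1 - y n) <= rho n * 2^-1 by have [] := fP (n, u n) (rho0 n).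
have yD n z : D n z -> 2 * rho n.+1 <= nrm (y n.+1 - z).
  by move=> Dz; have [_ _ _] := fP (n, u n) (rho0 n); exact.
have rhok n k : rho (n + k)%N <= rho n * 2^-1 ^+ k.
  elim: k => [|k IHk]; first by rewrite addn0 expr0 mulr1.
  rewrite addnS exprSr mulrA (le_trans (rhoS _)) // ler_wpM2r // invr_ge0 //.
have ysh n k : nrm (y (n + k.+1)%N - y (n + k)%N) <= rho n * 2^-1 * 2^-1 ^+ k.
  rewrite addnS (le_trans (yS _)) // mulrAC ler_wpM2r ?invr_ge0 //.
have [l lP] := @geometric_limit _ _ (fun k => y (0 + k)%N) _ (ysh 0%N).
have ly n : nrm (l - y n) <= rho n.
  apply/ler_addgt0Pr => e /(half_pow_small (2 * (rho 0%N * 2^-1)))[N NP].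
  have := @geometric_tail _ _ (fun k => y (n + k)%N) _ (ysh n) 0%N N.
  rewrite /= addn0 expr0 mulr1 add0n => h1.
  have h2 := le_lt_trans (lP (n + N)%N) (NP _ (leq_addl _ _)).
  rewrite add0n in h2; rewrite -(subrK (y (n + N)%N) l) -addrA.
  by rewrite (le_trans (nrmD _ _)) //; lra.
have [N NP] := cov l; have := yD N l (NP N (leqnn N)).
by rewrite nrm_distC; have := ly N.+1; have := rho0 N.+1; lra.
Qed.

(** The open mapping theorem, with [B r y] read as: [y] has a preimage of size at
    most [r]. Working with a relation covers preimages in a product of [X] with a
    finite power of the scalars without making that product a normed space. *)
Lemma open_mapping_relation (B : K -> X -> Prop) :
  (forall y, exists r, B r y) ->
  (forall r s y, r <= s -> B r y -> B s y) ->
  (forall r s y z, B r y -> B s z -> B (r + s) (y - z)) ->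
  (forall r t y, 0 < t -> B r y -> B (t * r) (t%:C%C *: y)) ->
  (forall r C y (z : nat -> X), (forall k, B (r * 2^-1 ^+ k) (z k)) ->
     (forall n, nrm (y - \sum_(k < n) z k) <= C * 2^-1 ^+ n) -> B (4 * r) y) ->
  exists2 C, 0 < C & forall y, y != 0 -> B (C * nrm y) y.
Proof.
move=> tot mono sub scl sum.
have [|n [y0 [rho [rho0 dense]]]] := @baire_somewhere_dense (fun n => B n%:R).
  move=> y; have [r rB] := tot y; exists (Num.truncn r).+1 => n rn.
  by apply: mono rB; rewrite (le_trans (ltW (truncnS_gt r))) // ler_nat.
pose M : K := n%:R + n%:R.
have M0 : 0 <= M by rewrite addr_ge0.
have dense0 y : nrm y < rho -> forall e, 0 < e -> exists2 z, B M z & nrm (y - z) < e.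
  move=> yr e e0; have e20 : 0 < e * 2^-1 by rewrite mulr_gt0 ?invr_gt0.
  have [|z1 Bz1 z1P] := dense (y + y0) _ _ e20; first by rewrite addrK.
  have [|z2 Bz2 z2P] := dense y0 _ _ e20; first by rewrite subrr nrm0.
  exists (z1 - z2); first exact: sub.
  have -> : y - (z1 - z2) = (y + y0 - z1) - (y0 - z2).
    rewrite !opprB [z2 - y0]addrC [RHS]addrA [y + y0 - z1]addrAC addrK.
    by rewrite addrA addrAC.
  by rewrite (le_lt_trans (nrmB _ _)) //; lra.
have denset t y : 0 < t -> nrm y < t * rho ->
    forall e, 0 < e -> exists2 z, B (t * M) z & nrm (y - z) < e.
  move=> t0 yt e e0.
  have tn0 : t%:C%C != 0 :> K[i] by rewrite -nrm_gt0 nrmR normr_gt0 gt_eqF.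
  have [||z Bz zP] := dense0 ((t%:C%C)^-1 *: y) _ (t^-1 * e).
  - by rewrite nrmZ nrmV nrmR gtr0_norm // ltr_pdivrMl.
  - by rewrite mulr_gt0 ?invr_gt0.
  exists (t%:C%C *: z); first exact: scl.
  rewrite -[y](scalerKV tn0) -scalerBr nrmZ nrmR gtr0_norm //.
  by rewrite -ltr_pdivlMl.
have half0 k : 0 < 2^-1 ^+ k :> K by rewrite exprn_gt0 ?invr_gt0.
have small y : nrm y < rho -> B (4 * M) y.
  move=> yr.
  have /choice[f fP] (s : nat * X) : exists z, nrm s.2 < 2^-1 ^+ s.1 * rho ->
      B (2^-1 ^+ s.1 * M) z /\ nrm (s.2 - z) < 2^-1 ^+ s.1.+1 * rho.
    have [sr|sr] := ltP (nrm s.2) (2^-1 ^+ s.1 * rho); last first.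
      by exists 0.
    have [|z Bz zP] := denset _ _ (half0 s.1) sr (2^-1 ^+ s.1.+1 * rho).
      by rewrite mulr_gt0.
    by exists z.
  pose u := fix u k := if k is m.+1 then u m - f (m, u m) else y.
  have uP k : nrm (u k) < 2^-1 ^+ k * rho.
    elim: k => [|k IHk]; first by rewrite expr0 mul1r.
    by have [] := fP (k, u k) IHk.
  apply: (sum M rho y (fun k => f (k, u k))) => [k|k].
    by rewrite mulrC; have [] := fP (k, u k) (uP k).
  have -> : y - \sum_(i < k) f (nat_of_ord i, u i) = u k.
    elim: k => [|k IHk]; first by rewrite big_ord0 subr0.
    by rewrite big_ord_recr /= opprD addrA IHk.
  by rewrite mulrC ltW.
exists (8 * M / rho + 1) => [|y y0'].
  by rewrite ltr_wpDl // divr_ge0 ?mulr_ge0 // ltW.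
have ny : 0 < nrm y by rewrite nrm_gt0.
pose t := 2 * nrm y / rho.
have t0 : 0 < t by rewrite divr_gt0 ?mulr_gt0.
have tn0 : t%:C%C != 0 :> K[i] by rewrite -nrm_gt0 nrmR normr_gt0 gt_eqF.
have /(scl _ _ _ t0) : B (4 * M) ((t%:C%C)^-1 *: y).
  apply: small; rewrite nrmZ nrmV nrmR gtr0_norm // ltr_pdivrMl // /t.
  by rewrite mulfVK ?gt_eqF //; lra.
rewrite scalerKV //; apply: mono.
have -> : t * (4 * M) = 8 * M / rho * nrm y by rewrite /t; ring.
by rewrite [leRHS]mulrDl mul1r lerDl ltW.
Qed.

Implicit Types (a b : endo X).

Lemma finite_upper_bound n (E : 'I_n -> K) : exists2 M, 0 <= M & forall i, E i <= M.
Proof.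
exists (\sum_i `|E i|) => [|i]; first by rewrite sumr_ge0.
by rewrite (bigD1 i) //= (le_trans (ler_norm _)) // lerDl sumr_ge0.
Qed.

(** Surjectivity up to the span of [b] suffices, and the coefficients are
    controlled as well: this is what makes ranges of finite codimension closed. *)
Lemma open_mapping a n (b : 'I_n -> X) :
  bounded a -> (forall y, exists x c, y = a x + lincomb c b) ->
  exists2 C, 0 < C & forall y, exists x c,
    [/\ y = a x + lincomb c b, nrm x <= C * nrm y & forall i, nrm (c i) <= C * nrm y].
Proof.
move=> [s [s0 as_]] sur.
pose B r y := exists x c, [/\ y = a x + lincomb c b, nrm x <= r & forall i, nrm (c i) <= r].
have [|r t y rt [x [c [yE xr cr]]]|||r C y z|C C0 BC] := @open_mapping_relation B.
- move=> y; have [x [c yE]] := sur y.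
  have [M M0 cM] := finite_upper_bound (fun i => nrm (c i)).
  exists (nrm x + M), x, c; split=> // [|i]; first by rewrite lerDl.
  by rewrite (le_trans (cM i)) // lerDr nrm_ge0.
- exists x, c; split=> // [|i]; first exact: le_trans rt.
  exact: le_trans rt.
- move=> r t y z [x [c [-> xr cr]]] [x' [c' [-> xr' cr']]].
  exists (x - x'), (fun i => c i - c' i); split=> [||i].
  + by rewrite appB lincombB opprD addrACA.
  + by rewrite (le_trans (nrmB _ _)) // lerD.
  + by rewrite (le_trans (nrmB _ _)) // lerD.
- move=> r t y t0 [x [c [-> xr cr]]].
  exists (t%:C%C *: x), (fun i => t%:C%C * c i); split=> [||i].
  + by rewrite scalerDr appZ lincombZ.
  + by rewrite nrmZ nrmR gtr0_norm // ler_pM2l.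
  + by rewrite nrmM nrmR gtr0_norm // ler_pM2l.
- move=> /choice[x] /choice[c] xc yz.
  have xr k : nrm (x k) <= r * 2^-1 ^+ k by have [] := xc k.
  have cr i k : nrm (c k i) <= r * 2^-1 ^+ k by have [] := xc k.
  have [k|xl xlP] := @geometric_limit _ _ (fun k => \sum_(j < k) x j) r.
    by rewrite big_ord_recr /= addrAC subrr add0r.
  have /choice[cl clP] i : exists l, forall k,
      nrm (l - \sum_(j < k) c j i) <= 4 * r * 2^-1 ^+ k.
    apply: (@complex_geometric_limit _ (fun k => \sum_(j < k) c j i)) => k.
    by rewrite big_ord_recr /= addrAC subrr add0r.
  have r0 : 0 <= r by have := xr 0%N; rewrite expr0 mulr1; exact: le_trans (nrm_ge0 _).
  exists xl, cl; split=> [||i]; last 2 first.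
  + have := xlP 0%N; rewrite big_ord0 subr0 expr0 mulr1 => /le_trans; apply; lra.
  + by have := clP i 0%N; rewrite big_ord0 subr0 expr0 mulr1.
  apply/eqP; rewrite -subr_eq0; apply/eqP.
  apply: (@half_pow_eq0 _ _ _ (C + s * (2 * r) + 4 * r * \sum_i nrm (b i))) => k.
  have zE : \sum_(j < k) z j =
      a (\sum_(j < k) x j) + lincomb (fun i => \sum_(j < k) c j i) b.
    elim: k => [|k IHk].
      rewrite !big_ord0 app0 add0r /lincomb big1 // => i _.
      by rewrite big_ord0 scale0r.
    have [zk _ _] := xc k.
    rewrite !big_ord_recr /= IHk appD {1}zk addrACA.
    congr (_ + _); rewrite -lincombD; apply: eq_lincomb => i.
    by rewrite big_ord_recr.
  have -> : y - (a xl + lincomb cl b) = (y - \sum_(j < k) z j)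
      - a (xl - \sum_(j < k) x j) - lincomb (fun i => cl i - \sum_(j < k) c j i) b.
    rewrite zE lincombB appB.
    set A1 := a (\sum_(j < k) x j); set A := a xl.
    set L := lincomb cl b; set L1 := lincomb _ b.
    have -> : - (A + L) = - (A1 + L1) - (A - A1) - (L - L1).
      rewrite !opprB !opprD [_ + (A1 - A)]addrACA addNr add0r.
      by rewrite addrACA addNr add0r.
    by rewrite !addrA.
  rewrite [leRHS]mulrDl [X in _ <= X + _]mulrDl (le_trans (nrmB _ _)) // lerD //.
    rewrite (le_trans (nrmB _ _)) // lerD // (le_trans (as_ _)) //.
    by rewrite -[leRHS]mulrA ler_wpM2l // xlP.
  rewrite (le_trans (nrm_sum _)) // mulrAC mulr_sumr; apply: ler_sum => i _.
  by rewrite nrmZ ler_wpM2r ?nrm_ge0.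
exists C => // y; have [->|y0] := eqVneq y 0; last exact: BC.
exists 0, (fun=> 0); rewrite nrm0 mulr0; split=> //; first by rewrite app0 lincomb0 addr0.
by move=> i; rewrite nrm0.
Qed.

Lemma bounded_inverse a b : bounded a -> a * b = 1 -> b * a = 1 -> bounded b.
Proof.
move=> ba ab ba1; have [|C C0 CP] := @open_mapping a 0 (fun=> 0) ba.
  move=> y; exists (b y), (fun=> 0); rewrite lincomb0 addr0.
  by rewrite -endoME ab.
exists C; split=> [|y]; first exact: ltW.
have [x [c [yE xC _]]] := CP y; rewrite {1}yE /lincomb big_ord0 addr0.
by rewrite -endoME ba1.
Qed.

End OpenMapping.

(** * The Hahn-Banach theorem and finite-dimensional projections *)

Section HahnBanach.
Context {K : realType} {X : normedModType K[i]}.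
Implicit Types (x y v : X) (s t : K) (p q : X -> K).

Local Notation "t *r x" := (real_complex_def (Phant K) t *: x) (at level 40).

Definition sublinear p : Prop :=
  (forall x y, p (x + y) <= p x + p y) /\ forall t x, 0 <= t -> p (t *r x) = t * p x.

Lemma sublinear0 p : sublinear p -> p 0 = 0.
Proof. by move=> [_ pZ]; rewrite -(scale0r (0 : X)) (pZ 0) // mul0r. Qed.

Lemma sublinear_ge p x : sublinear p -> - p (- x) <= p x.
Proof.
move=> sp; have [pD _] := sp; have := pD x (- x).
by rewrite subrr sublinear0 //; lra.
Qed.

Lemma sublinear_nrm : sublinear (nrm : X -> K).
Proof.
split=> [|t x t0]; first exact: nrmD.
by rewrite nrmZ nrmR ger0_norm.
Qed.

(** The infimum below is the largest sublinear functional under [p] whose value at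
    [- y] is at most [- p y]. *)
Definition push p y x : K := inf [set p (x + t *r y) - t * p y | t in [set t | 0 <= t]].

Lemma push_le p y x t : sublinear p -> 0 <= t -> push p y x <= p (x + t *r y) - t * p y.
Proof.
move=> sp t0; apply: ge_inf; last by exists t.
exists (- p (- x)) => _ [s s0 <-]; have [pD pZ] := sp.
have := pD (x + s *r y) (- x); rewrite addrAC subrr add0r pZ //; lra.
Qed.

Lemma le_push p y x b :
  (forall t, 0 <= t -> b <= p (x + t *r y) - t * p y) -> b <= push p y x.
Proof.
move=> bP; apply: lb_le_inf; first by exists (p (x + 0 *r y) - 0 * p y), 0 => /=.
by move=> _ [t t0 <-]; exact: bP.
Qed.

Lemma push_le_self p y x : sublinear p -> push p y x <= p x.
Proof.
move=> sp; have := push_le y x sp (lexx 0).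
by rewrite scale0r addr0 mul0r subr0.
Qed.

Lemma sublinear_push p y : sublinear p -> sublinear (push p y).
Proof.
move=> sp; have [pD pZ] := sp; split=> [x x'|].
  rewrite -lerBlDr; apply: le_push => t t0.
  rewrite lerBlDl -lerBlDr; apply: le_push => t' t0'.
  rewrite lerBlDr (le_trans (push_le _ _ sp (addr_ge0 t0 t0'))) //.
  have := pD (x + t *r y) (x' + t' *r y).
  by rewrite addrACA -scalerDl -(rmorphD (real_complex K)) /=; lra.
have pushZ s x : 0 < s -> push p y (s *r x) <= s * push p y x.
  move=> s0; rewrite mulrC -ler_pdivrMr //; apply: le_push => t t0.
  rewrite ler_pdivrMr // (le_trans (push_le _ _ sp (mulr_ge0 (ltW s0) t0))) //.
  rewrite (rmorphM (real_complex K)) /= -scalerA -scalerDr pZ; last exact: ltW.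
  by lra.
move=> t x; rewrite le_eqVlt => /orP[/eqP <-|t0].
  rewrite mul0r scale0r; apply/eqP; rewrite eq_le; apply/andP; split.
    by rewrite (le_trans (push_le_self _ _ sp)) // sublinear0.
  by apply: le_push => s s0; rewrite add0r pZ // subrr.
apply/eqP; rewrite eq_le pushZ //=.
have tn0 : t%:C%C != 0 :> K[i] by rewrite -nrm_gt0 nrmR normr_gt0 gt_eqF.
rewrite -ler_pdivlMl // -{1}[x](scalerK tn0) -(fmorphV (real_complex K)) /=.
by rewrite pushZ // invr_gt0.
Qed.

(** Take a minimal sublinear functional [f] below [p], by Zorn's lemma. Minimality
    gives [push f y = f], whence [f x <= f (x + y) - f y]. *)
Lemma exists_additive_below p : sublinear p ->
  exists f, [/\ sublinear f, forall x, f x <= p x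
              & forall x y, f (x + y) = f x + f y].
Proof.
move=> sp.
pose T := {f : X -> K | `[< sublinear f /\ forall x, f x <= p x >]}.
have TP (f : T) : sublinear (val f) /\ forall x, val f x <= p x.
  exact/asboolP/(valP f).
pose R (f g : T) := `[< forall x, val g x <= val f x >].
have pT : `[< sublinear p /\ forall x, p x <= p x >] by apply/asboolP; split.
have [|f g h /asboolP fg /asboolP gh|f g /asboolP fg /asboolP gf|A totA|f fmin] :=
    @Zorn T R.
- by move=> f; apply/asboolP.
- by apply/asboolP => x; exact: le_trans (gh x) (fg x).
- by apply/val_inj/funext => x; apply/eqP; rewrite eq_le fg gf.
- have [[f0 Af0]|nA] := pselect (exists f, A f); last first.
    by exists (Sub p pT) => g Ag; exfalso; apply: nA; exists g.
  pose q x := inf [set val f x | f in A].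
  have q_le f x : A f -> q x <= val f x.
    move=> Af; apply: ge_inf; last by exists f.
    exists (- p (- x)) => _ [g _ <-]; have [sg gp] := TP g.
    by apply: le_trans _ (sublinear_ge _ sg); rewrite lerN2.
  have le_q x b : (forall f, A f -> b <= val f x) -> b <= q x.
    move=> bP; apply: lb_le_inf; first by exists (val f0 x), f0.
    by move=> _ [f Af <-]; exact: bP.
  have sq : sublinear q.
    split=> [x y|t x t0].
      rewrite -lerBlDr; apply: (le_q) => f Af.
      rewrite lerBlDl -lerBlDr; apply: (le_q) => g Ag; rewrite lerBlDr.
      have [[fD _] _] := TP f; have [[gD _] _] := TP g.
      have [/asboolP fg|/asboolP gf] := totA f g Af Ag.
        apply: le_trans (q_le g _ Ag) _; apply: le_trans (gD _ _) _.
        by rewrite addrC lerD2l fg.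
      apply: le_trans (q_le f _ Af) _; apply: le_trans (fD _ _) _.
      by rewrite addrC lerD2r gf.
    have [->|tn0] := eqVneq t 0.
      rewrite mul0r scale0r; apply/eqP; rewrite eq_le; apply/andP; split.
        by have [sf _] := TP f0; rewrite -(sublinear0 sf); exact: q_le.
      by apply: (le_q) => f Af; have [sf _] := TP f; rewrite sublinear0.
    have tp : 0 < t by rewrite lt_def tn0.
    apply/eqP; rewrite eq_le; apply/andP; split.
      rewrite -ler_pdivrMl //; apply: (le_q) => f Af; rewrite ler_pdivrMl //.
      by have [[_ fZ] _] := TP f; rewrite -fZ //; exact: q_le.
    apply: (le_q) => f Af; have [[_ fZ] _] := TP f; rewrite fZ // ler_wpM2l //.
    exact: q_le.
  have qT : `[< sublinear q /\ forall x, q x <= p x >].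
    apply/asboolP; split=> // x; have [_ fp] := TP f0.
    exact: le_trans (q_le f0 x Af0) (fp x).
  by exists (Sub q qT) => g Ag; apply/asboolP => x; rewrite SubK; exact: q_le.
have [sf fp] := TP f; exists (val f); split=> // x y.
have pushT : `[< sublinear (push (val f) y) /\ forall x, push (val f) y x <= p x >].
  apply/asboolP; split=> [|z]; first exact: sublinear_push.
  exact: le_trans (push_le_self _ _ sf) (fp z).
have /(congr1 val) : Sub (push (val f) y) pushT = f.
  by apply: fmin; apply/asboolP => z; rewrite SubK; exact: push_le_self.
rewrite SubK => /(congr1 (fun h => h x)) pE.
apply/eqP; rewrite eq_le; apply/andP; split; first by case: sf.
have := push_le y x sf ler01; rewrite pE scale1r mul1r.
by rewrite lerBrDr.
Qed.

Definition bounded_form (h : X -> K[i]) : Prop :=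
  scalar h /\ exists2 C, 0 <= C & forall x, nrm (h x) <= C * nrm x.

(** A real functional [f] that is additive, dominated by the norm and at least the
    norm at [v] is made complex linear by [x |-> f x - i f (i x)]. *)
Theorem separating_form v : v != 0 -> exists2 h, bounded_form h & h v = 1.
Proof.
move=> v0.
have [f [[_ fZ] fp fD]] := exists_additive_below (sublinear_push v sublinear_nrm).
have fn x : f x <= nrm x := le_trans (fp x) (push_le_self _ _ sublinear_nrm).
have f0 : f 0 = 0 by rewrite -(scale0r (0 : X)) (fZ 0) // mul0r.
have fN x : f (- x) = - f x.
  by apply/eqP; rewrite -addr_eq0 -fD addNr f0.
have fZ' t x : f (t *r x) = t * f x.
  have [/fZ//|t0] := leP 0 t.
  have -> : t *r x = - ((- t) *r x) by rewrite (rmorphN (real_complex K)) scaleNr opprK.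
  by rewrite fN fZ ?oppr_ge0 ?ltW // mulNr opprK.
have fv : nrm v <= f v.
  have := le_trans (fp (- v)) (push_le v (- v) sublinear_nrm ler01).
  by rewrite scale1r addNr nrm0 mul1r sub0r fN lerN2.
have fabs x : `|f x| <= nrm x.
  by rewrite ler_norml lerNl -fN -{1}(nrmN x) !fn.
pose h x := Complex (f x) (- f ('i%C *: x)).
have hn x : nrm (h x) <= 2 * nrm x.
  rewrite (le_trans (nrm_ReIm _)) //= normrN.
  by have := fabs x; have := fabs ('i%C *: x); rewrite nrmZ nrmi mul1r; lra.
have hl : scalar h.
  move=> z x y; rewrite /h scalerDr !fD scalerA.
  case: z => a b.
  have zE : Complex a b = a%:C%C + b%:C%C * 'i%C by simpc.
  have izE : 'i%C * Complex a b = a%:C%C * 'i%C + (- b)%:C%C by simpc.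
  rewrite izE {1}zE !scalerDl -!scalerA !fD !fZ'.
  by simpc; congr Complex; ring.
have hv0 : h v != 0.
  rewrite -nrm_gt0 (lt_le_trans _ (nrm_Re _)) // (lt_le_trans _ (ler_norm _)) //.
  by rewrite /= (lt_le_trans _ fv) // nrm_gt0.
exists (fun x => h x / h v); last by rewrite divff.
split=> [t x y|]; first by rewrite hl mulrDl mulrA.
exists (2 / nrm (h v)) => [|x]; first by rewrite divr_ge0 ?nrm_ge0.
by rewrite nrmM nrmV mulrAC ler_wpM2r ?invr_ge0 ?nrm_ge0.
Qed.

End HahnBanach.

Section FiniteDimensionalProjection.
Context {K : realType} {X : completeNormedModType K[i]}.
Implicit Types (x y w : X) (h : X -> K[i]) (a : endo X).

Fact rank1_linear h (hb : bounded_form h) w : linear (fun x => h x *: w).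
Proof. by move=> t x y; have [-> _] := hb; rewrite scalerDl scalerA. Qed.
Definition rank1 h (hb : bounded_form h) w : endo X := Endo (rank1_linear hb w).

Lemma bounded_rank1 h (hb : bounded_form h) w : bounded (rank1 hb w).
Proof.
have [_ [C C0 hC]] := hb; exists (C * nrm w); split=> [|x].
  by rewrite mulr_ge0 ?nrm_ge0.
by rewrite /= nrmZ mulrAC ler_wpM2r ?nrm_ge0.
Qed.

(** Induction on [n]: the coordinate along a new vector comes from a form that is
    [1] on its component outside the span of the others. *)
Lemma bounded_coordinates n (v : 'I_n -> X) :
  exists2 f : 'I_n -> X -> K[i], forall i, bounded_form (f i)
    & forall c, lincomb (fun i => f i (lincomb c v)) v = lincomb c v.
Proof.
elim: n v => [|n IHn] v.
  by exists (fun=> fun=> 0) => [[]//|c]; rewrite /lincomb !big_ord0.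
have [f fb fP] := IHn (v \o lift ord0).
pose P : endo X := \sum_i rank1 (fb i) (v (lift ord0 i)).
have PE x : P x = lincomb (fun i => f i x) (v \o lift ord0).
  rewrite /P /lincomb (big_morph (fun a : endo X => a x) (id1 := 0) (op1 := +%R)) //.
have bP : bounded P by apply: bounded_sum => i; exact: bounded_rank1.
pose v0 := v ord0.
have [h hb hP] : exists2 h, bounded_form h &
    h (v0 - P v0) = 1 \/ v0 = P v0 /\ forall x, h x = 0.
  have [/eqP w0|w0] := eqVneq (v0 - P v0) 0.
    exists (fun=> 0); last by right; split=> //; apply/eqP; rewrite -subr_eq0.
    split=> [t x y|]; first by rewrite mulr0 addr0.
    by exists 0 => // x; rewrite nrm0 mul0r.
  by have [h hb hv] := separating_form w0; exists h => //; left.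
have h0 : h 0 = 0 by have [hl _] := hb; have := hl (-1) 0 0;
  rewrite scaler0 addr0 mulN1r addNr.
pose g x := h (x - P x).
have form_comp k (a : endo X) : bounded_form k -> bounded a -> bounded_form (k \o a).
  move=> [kl [C C0 kC]] [D [D0 aD]]; split=> [t x y|]; first by rewrite /= appD appZ kl.
  exists (C * D) => [|x]; first exact: mulr_ge0.
  by rewrite (le_trans (kC _)) // -mulrA ler_wpM2l.
have gb : bounded_form g.
  exact: (form_comp h (1 - P) hb (boundedB bounded1 bP)).
exists (fun i => oapp (fun j => f j \o (1 - rank1 gb v0 : endo X)) g (unlift ord0 i)).
  move=> i; case: unliftP => [j _|_] //=.
  exact: (form_comp _ _ (fb j) (boundedB bounded1 (bounded_rank1 gb v0))).
move=> c.
have lcE d : lincomb d v = d ord0 *: v0 + lincomb (d \o lift ord0) (v \o lift ord0).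
  by rewrite /lincomb big_ord_recl.
set y := lincomb (c \o lift ord0) (v \o lift ord0).
have Py : P y = y by rewrite PE fP.
have gE t : g (t *: v0 + y) = t * g v0.
  have [hl _] := hb.
  rewrite /g appD appZ Py opprD addrACA subrr -scalerBr.
  by rewrite hl h0 addr0.
rewrite !(lcE c) -/y [LHS]lcE /= unlift_none /=.
have [hv|[v0E h_0]] := hP.
  rewrite gE /g hv mulr1; congr (_ + _).
  rewrite -[RHS]fP; apply: eq_lincomb => i /=; rewrite liftK /=.
  by rewrite -/(g (c ord0 *: v0 + y)) gE /g hv mulr1 addrAC subrr add0r.
rewrite /g h_0 scale0r add0r.
have yE : P (c ord0 *: v0 + y) = c ord0 *: v0 + y by rewrite appD appZ -v0E Py.
rewrite -[RHS]yE PE.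
apply: eq_lincomb => i /=; rewrite liftK /=; congr (f i _).
by rewrite /g h_0 scale0r subr0.
Qed.

Lemma bounded_coordinates_indep n (v : 'I_n -> X) (f : 'I_n -> X -> K[i]) i j :
  indep_mod [set 0] v -> (forall c, lincomb (fun i => f i (lincomb c v)) v = lincomb c v) ->
  f i (v j) = (j == i)%:R.
Proof.
move=> iv fP; apply/eqP; rewrite -subr_eq0; apply/eqP.
apply: (iv (fun i => f i (v j) - (j == i)%:R)) => /=.
rewrite -/(lincomb _ _) lincombB lincomb_delta -[v j](lincomb_delta j v) fP; exact: subrr.
Qed.

Lemma finite_rank_bounded_coord a : a \in finite_rank -> bounded a ->
  exists n (v : 'I_n -> X) (f : 'I_n -> X -> K[i]),
    (forall i, bounded_form (f i)) /\ forall x, a x = lincomb (fun i => f i x) v.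
Proof.
move=> /finite_rankE[n [v av]] [D [D0 aD]]; have [f fb fP] := bounded_coordinates v.
exists n, v, (fun i => f i \o a); split=> [i|x]; last first.
  by have [c ac] := av x; rewrite ac -[LHS]fP; apply: eq_lincomb => i /=; rewrite ac.
have [fl [C C0 fC]] := fb i; split=> [t x y|]; first by rewrite /= appD appZ fl.
exists (C * D) => [|x]; first exact: mulr_ge0.
by rewrite (le_trans (fC _)) // -mulrA ler_wpM2l.
Qed.

End FiniteDimensionalProjection.

(** * Bounded parametrices *)

Section FredholmParametrix.
Context {K : realType} {X : completeNormedModType K[i]}.
Implicit Types (x y : X) (a u v p q : endo X).

(** Solve [y = a x] modulo a complement of the range, and normalize [x] by removing
    its component in the null space. The solution is then unique, hence linear,
    and the open mapping theorem bounds it. *)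
Lemma fredholm_bounded_parametrix a : bounded a -> fredholm a ->
  exists p, [/\ bounded p, cls (p * a) = 1 & cls (a * p) = 1].
Proof.
move=> ba [/finite_dimP[m [b [Nb spb]]] [n [w qw]]].
have [f fb fP] := bounded_coordinates b.
pose P : endo X := \sum_i rank1 (fb i) (b i).
have PE x : P x = lincomb (fun i => f i x) b.
  by rewrite /P /lincomb (big_morph (fun a : endo X => a x) (id1 := 0) (op1 := +%R)).
have bP : bounded P by apply: bounded_sum => i; exact: bounded_rank1.
have aP x : a (P x) = 0.
  by rewrite PE; apply/null_spaceP; exact: subspace_lincomb (subspace_null a) Nb.
have PN x : a x = 0 -> P x = x by move=> /null_spaceP/spb[c ->]; rewrite PE fP.
have sR := subspace_range a.
have [|C C0 om] := @open_mapping _ _ a n w ba.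
  move=> y; have [_ sp _] := qw; have [c [x _ xE]] := sp y I.
  by exists x, c; rewrite xE subrK.
have /choice[g gP] := om.
pose pf y := g y - P (g y).
have pE y x c : y = a x + lincomb c w -> pf y = x - P x.
  move=> yE; have [c' [yE' _ _]] := gP y.
  have cc : c =1 c'.
    apply: (quotient_basis_coord_uniq sR qw (x := y)); rewrite -/(lincomb _ _).
      by rewrite yE addrK; exists x.
    by rewrite {1}yE' addrK; exists (g y).
  have axg : a (g y - x) = 0.
    apply/eqP; rewrite appB subr_eq0; apply/eqP.
    apply: (addIr (lincomb c w)); rewrite -yE [RHS]yE'; congr (_ + _); exact: eq_lincomb.
  apply/eqP; rewrite -subr_eq0; apply/eqP.
  rewrite /pf opprB [P x - x]addrC addrACA [- _ + P x]addrC.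
  by rewrite -[P x - _]opprB -appB PN // subrr.
have pl : linear pf.
  move=> t y y'; have [c [yE _ _]] := gP y; have [c' [yE' _ _]] := gP y'.
  rewrite (pE _ (t *: g y + g y') (fun i => t * c i + c' i)).
    by rewrite /pf appD appZ scalerBr opprD addrACA.
  by rewrite {1}yE {1}yE' lincombD lincombZ appD appZ scalerDr addrACA.
pose p := Endo pl; have [D [D0 PD]] := bP.
exists p; split.
- exists (C + D * C); split=> [|y]; first by rewrite addr_ge0 ?mulr_ge0 // ltW.
  have [c [_ gy _]] := gP y; rewrite /= /pf (le_trans (nrmB _ _)) //.
  rewrite mulrDl lerD // (le_trans (PD _)) // -mulrA ler_wpM2l //.
- have -> : p * a = 1 - P.
    apply: endoP => x; rewrite !endoE -(pE (a x) x (fun=> 0)) //.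
    by rewrite lincomb0 addr0.
  rewrite clsB cls1 (cls_finite_rank (f := P)) ?subr0 //.
  by apply: (finite_rank_span (v := b)) => x; exists (fun i => f i x).
- apply/(clsP _ 1); rewrite -rpredN opprB; apply: (finite_rank_span (v := w)) => y.
  have [c [yE _ _]] := gP y; exists c.
  by rewrite !endoE /= /pf appB aP subr0 {1}yE addrAC subrr add0r.
Qed.

(** With index zero a basis of the null space can be mapped to a basis of a
    complement of the range; added to [a], this makes it bijective. *)
Lemma weyl_bounded a : bounded a -> weyl a ->
  exists u v, [/\ u * v = 1, v * u = 1, bounded u, bounded v & cls a = cls u].
Proof.
move=> ba /weyl_has_dim[n [[b [Nb spb ib]] [w [_ spw iw]]]].
have [f fb fP] := bounded_coordinates b.
pose F : endo X := \sum_i rank1 (fb i) (w i).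
have FE x : F x = lincomb (fun i => f i x) w.
  by rewrite /F /lincomb (big_morph (fun a : endo X => a x) (id1 := 0) (op1 := +%R)).
have bF : bounded F by apply: bounded_sum => i; exact: bounded_rank1.
have Fb j : F (b j) = w j.
  rewrite FE -(lincomb_delta j w); apply: eq_lincomb => i.
  exact: bounded_coordinates_indep ib fP.
have FF : F \in finite_rank.
  by apply: (finite_rank_span (v := w)) => x; exists (fun i => f i x).
have bu : bounded (a + F) by exact: boundedD.
have [x|y|v [uv vu]] := @bij_invertible _ _ (a + F).
- rewrite endoDE => ax.
  have f0 i : f i x = 0.
    apply: (iw (fun i => f i x)); rewrite -/(lincomb _ _) -FE; exists (- x) => //.
    by apply/eqP; rewrite appN eq_sym -addr_eq0 addrC ax.
  have F0 : F x = 0 by rewrite FE /lincomb big1 // => i _; rewrite f0 scale0r.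
  move: ax; rewrite F0 addr0 => /null_spaceP/spb[c] /eqP; rewrite subr_eq0 => /eqP xE.
  rewrite xE -/(lincomb _ _) -fP -/(lincomb c b) /lincomb big1 // => i _.
  by rewrite -/(lincomb c b) -[lincomb c b]xE f0 scale0r.
- have [c [x _ xE]] := spw y I.
  exists (x - lincomb (fun i => f i x) b + lincomb c b).
  have ab d : a (lincomb d b) = 0.
    by apply/null_spaceP; exact: subspace_lincomb (subspace_null a) Nb.
  have Flc d : F (lincomb d b) = lincomb d w.
    by rewrite app_lincomb; apply: eq_bigr => i _; rewrite /= Fb.
  rewrite endoDE !appD !appN !ab oppr0 !addr0 !Flc -FE subrr add0r xE -/(lincomb _ _).
  by rewrite subrK.
exists (a + F), v; split=> //; first exact: bounded_inverse bu uv vu.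
by rewrite clsD (cls_finite_rank FF) addr0.
Qed.

Lemma weyl_weyl_mod a : bounded a -> weyl a -> weyl_mod a.
Proof. by move=> ba /(weyl_bounded ba)[u [v [uv vu _ _ au]]]; exists u, v. Qed.

(** The coordinates modulo the range are bounded and vanish on the range, hence
    on its closure. *)
Lemma closed_range a : bounded a -> finite_codim (range a) -> closed (range a).
Proof.
move=> ba [n [w qw]]; have [_ sp iw] := qw; have sR := subspace_range a.
have [|C C0 om] := @open_mapping _ _ a n w ba.
  by move=> y; have [c [x _ xE]] := sp y I; exists x, c; rewrite xE subrK.
move=> y cly; have [x [c [yE _ _]]] := om y.
suff c0 : c =1 fun=> 0 by exists x => //; rewrite [RHS]yE (eq_lincomb _ c0) lincomb0 addr0.
move=> i; apply/eqP; rewrite -nrm_eq0 eq_le nrm_ge0 andbT.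
apply/ler_addgt0Pr => e e0; rewrite add0r.
have eC : 0 < e / C by rewrite divr_gt0.
have eC' : 0 < (e / C)%:C%C :> K[i] by rewrite ltcR.
have [_ [[z _ <-] /ball_nrm yz]] := cly _ (nbhsx_ballx y _ eC').
have [x' [c' [yE' _ c'C]]] := om (y - a z).
have -> : c i = c' i.
  apply: (quotient_basis_coord_uniq sR qw (x := y)); rewrite -/(lincomb _ _).
    by rewrite {1}yE addrK; exists x.
  exists (x' + z) => //; rewrite appD -[y in RHS](subrK (a z)) {1}yE'.
  by rewrite addrAC addrK.
by rewrite (le_trans (c'C i)) // mulrC -ler_pdivlMr // ltW.
Qed.

(** The projection reads off the part along the null space in a decomposition
    that the open mapping theorem controls. *)
Lemma browder_projection_bounded a q k : bounded a ->
  finite_dim (null_space a) ->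
  (forall x, q ((a ^+ k) x) = 0) -> (forall y, (a ^+ k) (q y) = 0) ->
  (forall z, (a ^+ k) z = 0 -> q z = z) ->
  (forall y, exists x, y = (a ^+ k) x + q y) -> bounded q.
Proof.
move=> ba fN qa aq qN dec.
have [n [b [Nb spb]]] := finite_dimP (finite_dim_nullX k fN).
have [|C C0 om] := @open_mapping _ _ (a ^+ k) n b (boundedX k ba).
  move=> y; have [x yE] := dec y; have [|c qE] := spb (q y); first exact: aq.
  by exists x, c; rewrite -qE.
exists (C * \sum_i nrm (b i)); split=> [|y].
  by rewrite mulr_ge0 ?sumr_ge0 ?ltW // => i _; exact: nrm_ge0.
have [x [c [yE _ cC]]] := om y.
have -> : q y = lincomb c b.
  rewrite yE appD qa add0r; apply: qN; apply/null_spaceP.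
  exact: subspace_lincomb (subspace_null _) Nb.
rewrite (le_trans (nrm_sum _)) // mulrAC mulr_sumr; apply: ler_sum => i _.
by rewrite nrmZ ler_wpM2r ?nrm_ge0.
Qed.

End FredholmParametrix.

(** * Riesz operators are essentially quasinilpotent *)

Section EssentialNorm.
Context {K : realType} {X : completeNormedModType K[i]}.
Implicit Types (q r g h : calkin X) (c d : K) (z : K[i]).

(** Upper bounds of the distance to finite rank; as a relation, this avoids
    infima and gives no bound at all to the classes without bounded members. *)
Definition ess_norm_le q c : Prop := exists2 a : endo X, cls a = q & op_norm_le a c.

Definition cscal z : calkin X := cls (scal z).

Lemma ess_norm_le_weaken q c d : c <= d -> ess_norm_le q c -> ess_norm_le q d.
Proof. by move=> cd [a aq ac]; exists a => //; exact: op_norm_le_weaken ac. Qed.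

Lemma ess_norm_le_ge0 q c : ess_norm_le q c -> 0 <= c. Proof. by move=> [a _ []]. Qed.

Lemma ess_norm_leD q r c d : ess_norm_le q c -> ess_norm_le r d ->
  ess_norm_le (q + r) (c + d).
Proof.
by move=> [a <- ac] [b <- bd]; exists (a + b); [exact: clsD | exact: op_norm_leD].
Qed.

Lemma ess_norm_leN q c : ess_norm_le q c -> ess_norm_le (- q) c.
Proof. by move=> [a <- ac]; exists (- a); [exact: clsN | exact: op_norm_leN]. Qed.

Lemma ess_norm_leB q r c d : ess_norm_le q c -> ess_norm_le r d ->
  ess_norm_le (q - r) (c + d).
Proof. by move=> qc rd; apply: ess_norm_leD => //; exact: ess_norm_leN. Qed.

Lemma ess_norm_leM q r c d : ess_norm_le q c -> ess_norm_le r d ->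
  ess_norm_le (q * r) (c * d).
Proof.
by move=> [a <- ac] [b <- bd]; exists (a * b); [exact: clsM | exact: op_norm_leM].
Qed.

Lemma ess_norm_le_cscal z : ess_norm_le (cscal z) (nrm z).
Proof. by exists (scal z) => //; exact: op_norm_le_scal. Qed.

Lemma cscal1 : cscal 1 = 1. Proof. by rewrite /cscal scal1 cls1. Qed.
Lemma cscalM y z : cscal (y * z) = cscal y * cscal z.
Proof. by rewrite /cscal scalM clsM. Qed.
Lemma cscalD y z : cscal (y + z) = cscal y + cscal z.
Proof. by rewrite /cscal scalD clsD. Qed.
Lemma cscal0 : cscal 0 = 0. Proof. by rewrite /cscal scal0 (raddf0 cls). Qed.
Lemma cscalN z : cscal (- z) = - cscal z.
Proof. by apply/eqP; rewrite -addr_eq0 -cscalD addNr cscal0. Qed.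
Lemma cscalX z n : cscal (z ^+ n) = cscal z ^+ n.
Proof. by elim: n => [|n IHn]; rewrite ?expr0 ?cscal1 // !exprS cscalM IHn. Qed.
Lemma cscalC z q : cscal z * q = q * cscal z.
Proof. by have [a <-] := cls_surj q; rewrite /cscal -!clsM scalC. Qed.

Lemma cscalZX z q n : (cscal z * q) ^+ n = cscal (z ^+ n) * q ^+ n.
Proof. by rewrite exprMn_comm ?cscalX //; exact: cscalC. Qed.

Definition inverse_of q g : Prop := q * g = 1 /\ g * q = 1.

Lemma inverse_of_uniq q g h : inverse_of q g -> inverse_of q h -> g = h.
Proof. by move=> [_ gq] [qh _]; rewrite -[g]mulr1 -qh mulrA gq mul1r. Qed.

Lemma inverse_ofC q g : inverse_of q g -> inverse_of g q.
Proof. by move=> []. Qed.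

Lemma inverse_ofM q r g h :
  inverse_of q g -> inverse_of r h -> inverse_of (q * r) (h * g).
Proof.
move=> [qg gq] [rh hr]; split.
  by rewrite mulrA -(mulrA q) rh mulr1.
by rewrite mulrA -(mulrA h) gq mulr1.
Qed.

Lemma ess_norm_le_neumann q c : ess_norm_le q c -> c <= 2^-1 ->
  exists g, [/\ inverse_of (1 - q) g, ess_norm_le g 2 & ess_norm_le (g - 1) (2 * c)].
Proof.
move=> [a <- ac] c2; have [g [ag ga g2 g1]] := neumann ac c2.
exists (cls g); split; last 1 first.
- by exists (g - 1) => //; rewrite clsB cls1.
- by split; rewrite -cls1 -clsB -clsM ?ag ?ga.
- by exists g.
Qed.

Section RieszPowers.
Context (r : calkin X) (r_bounded : exists c, ess_norm_le r c).
Context (r_resolvent : forall z, exists g c,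
  inverse_of (1 - cscal z * r) g /\ ess_norm_le g c).

Lemma resolvent_continuous (y : K[i]) (e : K) : 0 < e -> exists2 d : K, 0 < d &
  forall z, nrm (z - y) < d -> forall g h, inverse_of (1 - cscal z * r) g ->
    inverse_of (1 - cscal y * r) h -> ess_norm_le (g - h) e.
Proof.
move=> e0; have [h [c [yh hc]]] := r_resolvent y; have [cr rc] := r_bounded.
have c0 := ess_norm_le_ge0 hc; have d0 := ess_norm_le_ge0 (ess_norm_leM hc rc);
  set d := c * cr in d0.
pose D := Num.min (2^-1 / (d + 1)) (e / (2 * (d + 1) * (c + 1))).
have d1 : 0 < d + 1 by lra.
have c1 : 0 < c + 1 by lra.
exists D => [|z zy g h' zg yh'].
  by rewrite lt_min !divr_gt0 ?invr_gt0 // !mulr_gt0.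
have {h' yh'} -> : h' = h by exact: inverse_of_uniq yh' yh.
set m := nrm (z - y) in zy; have m0 : 0 <= m by exact: nrm_ge0.
move: zy; rewrite lt_min !ltr_pdivlMr ?mulr_gt0 // => /andP[zy1 zy2].
have md : m * d <= m * (d + 1) by rewrite ler_wpM2l //; lra.
have ebE : ess_norm_le (cscal (z - y) * (h * r)) (m * d).
  by apply: ess_norm_leM; [exact: ess_norm_le_cscal | exact: ess_norm_leM].
have [|k [ek _ k1]] := ess_norm_le_neumann ebE; first by lra.
have -> : g = k * h.
  apply: (inverse_of_uniq zg).
  have -> : 1 - cscal z * r = (1 - cscal y * r) * (1 - cscal (z - y) * (h * r)).
    have [yh1 _] := yh; rewrite mulrBr mulr1.
    have -> : (1 - cscal y * r) * (cscal (z - y) * (h * r)) = cscal (z - y) * r.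
      by rewrite mulrA -cscalC -mulrA [X in _ * X]mulrA yh1 mul1r.
    by rewrite cscalD cscalN mulrBl opprB addrA subrK.
  exact: inverse_ofM.
have -> : k * h - h = (k - 1) * h by rewrite mulrBl mul1r.
apply: ess_norm_le_weaken (ess_norm_leM k1 hc).
have : 2 * (m * d) * c <= 2 * (m * (d + 1)) * (c + 1).
  apply: ler_pM => //; last by lra.
    by apply: mulr_ge0 => //; apply: mulr_ge0.
  by rewrite ler_wpM2l.
lra.
Qed.

(** Heine-Cantor, on a square that contains the disc. *)
Lemma resolvent_uniformly_continuous (rho e : K) : 0 < e -> exists2 d : K, 0 < d &
  forall y z, nrm y <= rho -> nrm (z - y) < d -> forall g h,
    inverse_of (1 - cscal z * r) g -> inverse_of (1 - cscal y * r) h ->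
      ess_norm_le (g - h) e.
Proof.
move=> e0; pose Q := `[- rho, rho]%classic `*` `[- rho, rho]%classic : set (K * K).
have cQ : compact Q by apply: compact_setX; exact: segment_compact.
pose P (d : K) (x : K * K) := forall z, nrm (z - Complex x.1 x.2) < d -> forall g h,
    inverse_of (1 - cscal z * r) g -> inverse_of (1 - cscal (Complex x.1 x.2) * r) h ->
    ess_norm_le (g - h) e.
have /(_ _ (0 : K)^'+ P _) : near_covering Q by exact/compact_near_coveringP.
case=> [[a b] _|d /= d0 dP].
  have e2 : 0 < e / 2 by lra.
  have [d d0 dP] := resolvent_continuous (Complex a b) e2.
  have d4 : 0 < d / 4 by lra.
  exists (ball (a, b) (d / 4), [set s : K | s < d / 2]) => /=.
    split; first exact: nbhsx_ballx.
    by apply: nbhs_right_lt; lra.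
  move=> [[a' b'] s] /= [[aa bb] sd] z zs g h zg yh.
  have yy : nrm (Complex a' b' - Complex a b) < d / 2.
    have -> : Complex a' b' - Complex a b = Complex (a' - a) (b' - b) by [].
    rewrite (le_lt_trans (nrm_ReIm _)) //=.
    move: aa bb;
      rewrite -!ball_normE /ball_ /= [`|a - a'|]distrC [`|b - b'|]distrC => aa bb.
    have quarter (u v : K) : u < d / 4 -> v < d / 4 -> u + v < d / 2 by lra.
    exact: quarter.
  have [k [c [k1 _]]] := r_resolvent (Complex a b).
  have -> : g - h = (g - k) - (h - k) by rewrite opprB addrA subrK.
  apply: (@ess_norm_le_weaken _ (e / 2 + e / 2)); first by lra.
  have halves (u v : K) : u < d / 2 -> v < d / 2 -> u + v < d by lra.
  have d2 : d / 2 < d by lra.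
  apply: ess_norm_leB; last exact: (dP _ (lt_trans yy d2) _ _ yh k1).
  apply: (dP z _ _ _ zg k1).
  rewrite -(subrK (Complex a' b') z) -addrA (le_lt_trans (nrmD _ _)) //.
  exact: halves _ _ (lt_trans zs sd) yy.
exists (d / 2); first by lra.
move=> y z yr zy g h zg yh; have d20 : 0 < d / 2 by lra.
have d2d : d / 2 < d by lra.
apply: (dP (d / 2) _ d20 (complex.Re y, complex.Im y) _ z) => //=.
- by rewrite /ball /= sub0r normrN gtr0_norm.
- by split; rewrite /= in_itv /= -ler_norml; apply: le_trans yr;
     [exact: nrm_Re | exact: nrm_Im].
- by case: (y) zy.
- by case: (y) yh.
Qed.

(** Rotating [y] by such a root turns [(y r) ^ (2 ^ k)] into its opposite. *)
Lemma root_of_minus_one k : exists2 z : K[i], z ^+ (2 ^ k) = -1 & nrm z = 1.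
Proof.
have k0 : (0 < 2 ^ k)%N by rewrite expn_gt0.
have zk : ((2 ^ k).-root (-1) : K[i]) ^+ (2 ^ k) = -1 by rewrite rootCK.
exists ((2 ^ k).-root (-1)) => //; apply/eqP.
by rewrite -(pexpr_eq1 k0) ?nrm_ge0 // -nrmX zk nrmN nrm1.
Qed.

Lemma cscal_expr2S y k : (cscal y * r) ^+ (2 ^ k.+1) = ((cscal y * r) ^+ (2 ^ k)) ^+ 2.
Proof. by rewrite expnSr exprM. Qed.

Lemma rotate_power y z k : z ^+ (2 ^ k) = -1 ->
  (cscal (z * y) * r) ^+ (2 ^ k) = - (cscal y * r) ^+ (2 ^ k).
Proof. by move=> zk; rewrite !cscalZX exprMn zk mulN1r cscalN mulNr. Qed.

(** The partial fractions of [(1 - x ^ 2)^-1]. *)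
Lemma inverse_square (x g h : calkin X) :
  inverse_of (1 - x) g -> inverse_of (1 - (- x)) h ->
  inverse_of (1 - x ^+ 2) (cscal 2^-1 * (g + h)).
Proof.
rewrite opprK => -[xg gx] [xh hx].
have e1 : (1 - x) * (1 + x) = 1 - x ^+ 2.
  by rewrite mulrDr mulr1 mulrBl mul1r addrA subrK expr2.
have e2 : (1 + x) * (1 - x) = 1 - x ^+ 2.
  by rewrite mulrBr mulr1 mulrDl mul1r opprD addrA addrK expr2.
have half2 : cscal 2^-1 * (1 + x + (1 - x)) = 1.
  rewrite addrACA subrr addr0 mulrDr mulr1 -cscalD.
  by rewrite (_ : 2^-1 + 2^-1 = 1 :> K[i]) ?cscal1 //; field.
split.
  rewrite mulrA -cscalC -mulrA mulrDr -{1}e2 -[X in _ * (_ + X * _)]e1.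
  by rewrite -2!mulrA xg xh !mulr1.
rewrite -mulrA mulrDl -{1}e1 -[X in _ * (_ + _ * X)]e2.
by rewrite [g * _]mulrA gx [h * _]mulrA hx !mul1r.
Qed.

Lemma power_resolvent k y : exists g, inverse_of (1 - (cscal y * r) ^+ (2 ^ k)) g.
Proof.
elim: k y => [|k IHk] y.
  by have [g [c [yg _]]] := r_resolvent y; exists g.
have [z zk _] := root_of_minus_one k; have [g yg] := IHk y; have [h zh] := IHk (z * y).
exists (cscal 2^-1 * (g + h)); rewrite cscal_expr2S.
by apply: inverse_square => //; rewrite -(rotate_power y zk).
Qed.

(** The inverses at level [k + 1] are means of two inverses at level [k], taken at
    points rotated by the same angle; distances between points are preserved, so
    [d] does not depend on [k]. *)
Lemma power_resolvent_uniformly_continuous (rho e : K) : 0 < e ->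
  exists2 d : K, 0 < d &
  forall k y z, nrm y <= rho -> nrm (z - y) < d -> forall g h,
    inverse_of (1 - (cscal z * r) ^+ (2 ^ k)) g ->
    inverse_of (1 - (cscal y * r) ^+ (2 ^ k)) h -> ess_norm_le (g - h) e.
Proof.
move=> e0; have [d d0 dP] := resolvent_uniformly_continuous rho e0.
exists d => //; elim=> [|k IHk] y z yr zy g h zg yh.
  by apply: dP yr zy _ _ _ _; rewrite expn0 expr1 in zg yh.
have [w wk w1] := root_of_minus_one k.
have [g1 zg1] := power_resolvent k z; have [g2 zg2] := power_resolvent k (w * z).
have [h1 yh1] := power_resolvent k y; have [h2 yh2] := power_resolvent k (w * y).
have -> : g = cscal 2^-1 * (g1 + g2).
  apply: inverse_of_uniq zg _; rewrite cscal_expr2S; apply: inverse_square => //.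
  by rewrite -(rotate_power z wk).
have -> : h = cscal 2^-1 * (h1 + h2).
  apply: inverse_of_uniq yh _; rewrite cscal_expr2S; apply: inverse_square => //.
  by rewrite -(rotate_power y wk).
rewrite -mulrBr opprD addrACA.
have h2e : nrm (2^-1 : K[i]) = 2^-1.
  by rewrite nrmV -(rmorph_nat (real_complex K)) nrmR ger0_norm.
apply: (@ess_norm_le_weaken _ (2^-1 * (e + e))); first by lra.
apply: ess_norm_leM; first by rewrite -h2e; exact: ess_norm_le_cscal.
apply: ess_norm_leD; first exact: IHk zg1 yh1.
apply: IHk zg2 yh2; first by rewrite nrmM w1 mul1r.
by rewrite -mulrBr nrmM w1 mul1r.
Qed.

Definition powers_vanish (s : K) : Prop := forall e : K, 0 < e ->
  exists k0, forall k, (k0 <= k)%N -> ess_norm_le ((cscal s%:C%C * r) ^+ (2 ^ k)) e.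

Lemma powers_vanish0 : powers_vanish 0.
Proof.
move=> e e0; exists 0%N => k _; apply: (@ess_norm_le_weaken _ 0); first exact: ltW.
have k0 : (0 < 2 ^ k)%N by rewrite expn_gt0.
rewrite cscal0 mul0r expr0n eqn0Ngt k0 /=; exists 0; [exact: raddf0 | exact: op_norm_le0].
Qed.

(** If the powers vanish at [s], the inverses of [1 - (s r) ^ (2 ^ k)] are close
    to [1], hence so are those at a slightly larger radius. This bounds the powers
    there, and makes them vanish at any smaller radius. *)
Lemma powers_vanish_step (rho : K) : exists2 d : K, 0 < d &
  forall s t, 0 <= s <= rho -> s <= t <= s + d -> powers_vanish s -> powers_vanish t.
Proof.
have e8 : 0 < 8^-1 :> K by rewrite invr_gt0.
have [d d0 dP] := power_resolvent_uniformly_continuous rho e8.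
exists (d / 3); first by lra.
move=> s t /andP[s0 sr] /andP[st td] sv; pose s' := s + d / 2.
have s'0 : 0 < s' by rewrite /s'; lra.
have e16 : 0 < 16^-1 :> K by rewrite invr_gt0.
have [k0 k0P] := sv _ e16.
have s'b k : (k0 <= k)%N -> ess_norm_le ((cscal s'%:C%C * r) ^+ (2 ^ k)) 2^-1.
  move=> /k0P/ess_norm_le_neumann[|g [sg _ g1]]; first by rewrite lef_pV2 ?posrE // ler_nat.
  have [g' s'g'] := power_resolvent k (s'%:C%C).
  have g'g : ess_norm_le (g' - g) 8^-1.
    apply: dP s'g' sg; first by rewrite nrmR ger0_norm.
    rewrite -(rmorphB (real_complex K)) nrmR /s' addrAC subrr add0r ger0_norm; lra.
  have /ess_norm_le_neumann[|h [g'h _ h1]] : ess_norm_le (1 - g') 4^-1.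
    rewrite -opprB; apply: ess_norm_leN; rewrite -(subrK g g') -addrA.
    by apply: ess_norm_le_weaken (ess_norm_leD g'g g1); lra.
    lra.
  rewrite opprB addrC subrK in g'h.
  have hE := inverse_of_uniq g'h (inverse_ofC s'g').
  rewrite hE addrAC subrr add0r in h1.
  by rewrite -[X in ess_norm_le X _]opprK; apply: ess_norm_leN;
    apply: ess_norm_le_weaken h1; lra.
move=> e e0.
have ts : 0 <= t / s' < 1.
  apply/andP; split; first by apply: divr_ge0; lra.
  by rewrite ltr_pdivrMr // mul1r /s'; lra.
have [N NP] := pow_small 2^-1 ts e0.
exists (maxn k0 N) => k; rewrite geq_max => /andP[k0k Nk].
have -> : cscal t%:C%C * r = cscal (t / s')%:C%C * (cscal s'%:C%C * r).
  by rewrite mulrA -cscalM -(rmorphM (real_complex K)) /= divfK // gt_eqF.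
rewrite cscalZX; have /andP[ts0 _] := ts.
apply: (@ess_norm_le_weaken _ ((t / s') ^+ (2 ^ k) * 2^-1)).
  by rewrite mulrC ltW // NP // (leq_trans Nk) // ltnW // ltn_expl.
apply: ess_norm_leM; last exact: s'b.
rewrite -[X in ess_norm_le _ X](_ : nrm ((t / s')%:C%C ^+ (2 ^ k)) = _);
  first exact: ess_norm_le_cscal.
by rewrite nrmX nrmR ger0_norm.
Qed.

(** The step [d] does not depend on the radius reached so far. *)
Theorem riesz_powers_vanish (rho : K) : 0 <= rho -> powers_vanish rho.
Proof.
move=> rho0; have [d d0 dP] := powers_vanish_step rho.
suff H j s : 0 <= s <= rho -> s <= j%:R * d -> powers_vanish s.
  apply: (H (Num.truncn (rho / d)).+1); first by rewrite rho0 lexx.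
  by rewrite -ler_pdivrMr // ltW // truncnS_gt.
elim: j s => [|j IHj] s /andP[s0 sr] sj.
  have -> : s = 0 by apply/eqP; rewrite eq_le s0 andbT; move: sj; rewrite mul0r.
  exact: powers_vanish0.
rewrite -natr1 mulrDl mul1r in sj.
have [sd|sd] := leP s d.
  by apply: (dP 0 s _ _ powers_vanish0); rewrite ?lexx ?rho0 ?s0 ?add0r.
apply: (dP (s - d) s); [|by rewrite subrK lexx andbT; lra|apply: IHj; lra]; lra.
Qed.

End RieszPowers.
End EssentialNorm.

(** * Perturbations of the identity with small essential powers *)

Section PerturbationOfIdentity.
Context {K : realType} {X : completeNormedModType K[i]}.
Implicit Types (x y : X) (a b u v D F : endo X) (c s t : K).

(** Connectedness of the unit interval, through the supremum of the points where
    [P] holds. *)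
Lemma locally_constant_unit_interval (P : K -> Prop) :
  (forall t, 0 <= t <= 1 -> exists2 d : K, 0 < d &
     forall s, 0 <= s <= 1 -> `|s - t| <= d -> P s <-> P t) ->
  P 0 -> P 1.
Proof.
move=> loc P0; pose A := [set t | 0 <= t <= 1 /\ P t].
have A0 : A 0 by split=> //; rewrite lexx ler01.
have supA : has_sup A.
  by split; [exists 0 | exists 1 => t [/andP[]]].
have ub t : A t -> t <= sup A by apply: ub_le_sup; exact: supA.2.
have s01 : 0 <= sup A <= 1.
  apply/andP; split; first exact: ub.
  by apply: ge_sup => [|t [/andP[]]]; [exists 0 |].
have [d d0 dP] := loc _ s01.
have [t [t01 Pt] td] := sup_adherent d0 supA.
have ts : t <= sup A by exact: ub.
have Ps : P (sup A).
  by apply/(dP t) => //; rewrite distrC ger0_norm; lra.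
have [s1|s1] := leP 1 (sup A).
  by rewrite (_ : 1 = sup A) //; apply/eqP; rewrite eq_le s1; case/andP: s01.
have dS : 0 < Num.min d (1 - sup A) by rewrite lt_min d0 subr_gt0.
have md : Num.min d (1 - sup A) <= d by rewrite ge_min lexx.
have m1 : Num.min d (1 - sup A) <= 1 - sup A by rewrite ge_min lexx orbT.
case/andP: s01 => s0 _.
have : A (sup A + Num.min d (1 - sup A)).
  have I01 : 0 <= sup A + Num.min d (1 - sup A) <= 1 by apply/andP; split; lra.
  split=> //; apply/dP => //.
  by rewrite addrAC subrr add0r ger0_norm // ltW.
by move=> /ub; lra.
Qed.

Section GeometricSum.
Context {A : pzRingType}.
Implicit Types q g : A.

Lemma comm_geometric_sum q n : GRing.comm (1 - q) (\sum_(i < n) q ^+ i).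
Proof.
apply: commr_sum => i _; apply: commrX; apply: commr_sym.
by apply: commrB; [exact: commr1 | exact: commr_refl].
Qed.

Lemma mul_geometric_sum q n : (1 - q) * (\sum_(i < n) q ^+ i) = 1 - q ^+ n.
Proof. by rewrite -opprB mulNr -subrX1 opprB. Qed.

Lemma geometric_sum_mul q n : (\sum_(i < n) q ^+ i) * (1 - q) = 1 - q ^+ n.
Proof. by rewrite -mul_geometric_sum comm_geometric_sum. Qed.

End GeometricSum.

(** [1 - q ^ n] is the product of [1 - q] with a polynomial in [q]. *)
Lemma inverse_of_power (q : calkin X) n (g : calkin X) :
  inverse_of (1 - q ^+ n) g ->
  inverse_of (1 - q) ((\sum_(i < n) q ^+ i) * g).
Proof.
move=> [qg gq]; set s := \sum_(i < n) q ^+ i.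
have s1 : (1 - q) * s = 1 - q ^+ n := mul_geometric_sum q n.
have s2 : s * (1 - q) = 1 - q ^+ n := geometric_sum_mul q n.
have sg : s * g = g * s.
  have sq : GRing.comm s (1 - q ^+ n).
    rewrite -s1; apply: commrM (commr_refl s).
    by apply: commr_sym; exact: comm_geometric_sum.
  by rewrite -[LHS]mul1r -gq -mulrA [_ * (s * g)]mulrA -sq -mulrA qg mulr1.
by split; [rewrite mulrA s1 | rewrite sg -mulrA s2].
Qed.

(** All the [1 - t b] with [t] in the unit interval have bounded parametrices. If
    [p] is one at [t], then [p (1 - u b)] is close to [1] modulo finite rank for
    [u] near [t], so being of index zero is the same for [1 - u b] and for [p]. *)
Lemma weyl_mod_one_sub b n c : ess_norm_le (cls b ^+ n) c -> c <= 2^-1 -> bounded b ->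
  weyl_mod (1 - b).
Proof.
move=> bn c2 bb; have c0 := ess_norm_le_ge0 bn; set q := cls b in bn.
have [M qM] : exists M, ess_norm_le q M by have [M bM] := bb; exists M, b.
have ebX k : exists C, ess_norm_le (q ^+ k) C.
  elim: k => [|k [C qC]]; first by exists (nrm 1); rewrite expr0 -cscal1;
    exact: ess_norm_le_cscal.
  by exists (M * C); rewrite exprS; exact: ess_norm_leM.
have res t : 0 <= t <= 1 -> exists g C,
    inverse_of (1 - cscal t%:C%C * q) g /\ ess_norm_le g C.
  move=> /andP[t0 t1].
  have tn : ess_norm_le ((cscal t%:C%C * q) ^+ n) c.
    rewrite cscalZX; apply: (@ess_norm_le_weaken _ _ _ (nrm (t%:C%C ^+ n) * c)); last first.
      by apply: ess_norm_leM => //; exact: ess_norm_le_cscal.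
    by rewrite nrmX nrmR ger0_norm // ler_piMl // exprn_ile1.
  have [g [tg g2 _]] := ess_norm_le_neumann tn c2.
  have := inverse_of_power tg; set s := \sum_(i < n) _ => sg.
  have [C sC] : exists C, ess_norm_le s C.
    rewrite /s; elim/big_ind: _ => [|x y [Cx xC] [Cy yC]|i _].
    - by exists 0; exists 0; [exact: raddf0 | exact: op_norm_le0].
    - by exists (Cx + Cy); exact: ess_norm_leD.
    - have [C iC] := ebX i; exists (nrm (t%:C%C ^+ i) * C); rewrite cscalZX.
      by apply: ess_norm_leM => //; exact: ess_norm_le_cscal.
  by exists (s * g), (C * 2); split=> //; exact: ess_norm_leM.
pose P t := weyl_mod (1 - scal t%:C%C * b).
suff : P 1 by rewrite /P scal1 mul1r.
apply: (locally_constant_unit_interval (P := P)) => [t t01|]; last first.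
  by rewrite /P scal0 mul0r subr0; apply: (@weyl_mod_inv _ _ _ 1); rewrite mulr1.
have [g [C [[tg gt] [p pg pC]]]] := res t t01; have [N bN] := bb.
have [pb0 _] := op_norm_leM pC bN; set e := C * N in pb0.
have e1 : 0 < e + 1 by lra.
exists (2^-1 / (e + 1)) => [|s s01 st]; first by rewrite divr_gt0 ?invr_gt0.
suff near (u : K) : `|u - t| <= 2^-1 / (e + 1) -> weyl_mod (p * (1 - scal u%:C%C * b)).
  have pt := near t; rewrite subrr normr0 in pt.
  have h2 : 0 < 2^-1 :> K by rewrite invr_gt0.
  have {}pt := pt (ltW (divr_gt0 h2 e1)); have ps := near _ st; split=> w.
    exact: weyl_mod_divl pt (weyl_mod_divr ps w).
  exact: weyl_mod_divl ps (weyl_mod_divr pt w).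
move=> ut; have ue : op_norm_le (scal (u - t)%:C%C * (p * b)) (`|u - t| * e).
  by rewrite -nrmR; apply: op_norm_leM; [exact: op_norm_le_scal | exact: op_norm_leM].
have [|h [uh hu _ _]] := neumann ue.
  have : `|u - t| * e <= `|u - t| * (e + 1) by rewrite ler_wpM2l //; lra.
  by move: ut; rewrite ler_pdivlMr //; lra.
apply: weyl_mod_congr (weyl_mod_inv uh hu).
rewrite !(clsB, clsM) pg cls1 -/(cscal _) mulrBr mulr1.
rewrite (rmorphB (real_complex K)) /= cscalD cscalN mulrBl.
have -> : g * (cls (scal u%:C%C) * cls b) = cscal u%:C%C * (g * q).
  by rewrite mulrA -cscalC mulrA.
have gq : g = 1 + cscal t%:C%C * (g * q).
  by rewrite -[in RHS]gt mulrBr mulr1 [g * (cscal _ * q)]mulrA -cscalC -mulrA subrK.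
by rewrite opprB addrA [X in _ = X - _]gq.
Qed.

(** Riesz's lemma for the closed null space of [a ^ p] in that of [a ^ p.+1]. *)
Lemma riesz_null_chain a p x : bounded a ->
  (a ^+ p.+1) x = 0 -> (a ^+ p) x <> 0 ->
  exists y, [/\ (a ^+ p.+1) y = 0, nrm y <= 2
    & forall m, (a ^+ p) m = 0 -> 1 <= nrm (y - m)].
Proof.
move=> ba ax /eqP ax0; have [C [C0 aC]] := boundedX p ba.
pose A : set K := [set nrm (x - m) | m in null_space (a ^+ p)].
have lbA m : null_space (a ^+ p) m -> nrm ((a ^+ p) x) / (C + 1) <= nrm (x - m).
  move=> /null_spaceP am; rewrite ler_pdivrMr; last by lra.
  rewrite -[(a ^+ p) x]subr0 -am -appB (le_trans (aC _)) // mulrC.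
  by rewrite ler_wpM2l ?nrm_ge0 //; lra.
have d00 : 0 < nrm ((a ^+ p) x) / (C + 1) by rewrite divr_gt0 ?nrm_gt0 //; lra.
have infA : has_inf A.
  split; first by exists (nrm (x - 0)), 0 => //; exact: app0.
  by exists (nrm ((a ^+ p) x) / (C + 1)) => _ [m /lbA h <-].
have d0 : 0 < inf A.
  apply: lt_le_trans d00 _; apply: lb_le_inf; first exact: infA.1.
  by move=> _ [m /lbA h <-].
have [_ [m0 /null_spaceP am0 <-] m0d] := inf_adherent d0 infA.
set d := inf A in d0 m0d.
have dn0 : d%:C%C != 0 :> K[i] by rewrite -nrm_gt0 nrmR normr_gt0 gt_eqF.
have nd z : nrm ((d%:C%C)^-1 *: z) = nrm z / d.
  by rewrite nrmZ nrmV nrmR gtr0_norm // mulrC.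
exists ((d%:C%C)^-1 *: (x - m0)); split.
- by rewrite appZ appB ax exprS endoME am0 app0 subr0 scaler0.
- by rewrite nd ler_pdivrMr // ltW //; lra.
- move=> m am; rewrite -[m](scalerK dn0) -scalerBr nd ler_pdivlMr // mul1r.
  rewrite -addrA -opprD; apply: ge_inf; first exact: infA.2.
  exists (m0 + d%:C%C *: m) => //; apply/null_spaceP.
  by rewrite appD appZ am am0 scaler0 addr0.
Qed.

(** Pigeonhole principle: round the real and imaginary parts of the coordinates to
    a grid of mesh [e / 2]. *)
Lemma bounded_sequence_close_terms m (z : nat -> 'I_m -> K[i]) (M e : K) :
  (forall p i, nrm (z p i) <= M) -> 0 < e ->
  exists j p, (j < p)%N /\ forall i, nrm (z p i - z j i) <= e.
Proof.
move=> zM e0; pose N := Num.truncn (4 * M / e).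
have trunc_close (u v : K) : 0 <= u -> 0 <= v ->
    Num.truncn (u * (2 / e)) = Num.truncn (v * (2 / e)) -> `|u - v| <= e / 2.
  move=> u0 v0 uv; have e2 : 0 < 2 / e by rewrite divr_gt0.
  have /andP[u1 u2] := truncn_itv (mulr_ge0 u0 (ltW e2)).
  have /andP[v1 v2] := truncn_itv (mulr_ge0 v0 (ltW e2)).
  rewrite uv in u1 u2; rewrite -natr1 in u2 v2.
  rewrite -[X in `|X|](mulfK (lt0r_neq0 e2)) mulrBl normrM [X in _ * X]gtr0_norm ?invr_gt0 //.
  rewrite invf_div -[leRHS]mul1r ler_wpM2r //; first by rewrite divr_ge0 // ltW.
  by rewrite ler_norml; apply/andP; split; lra.
pose re p i := complex.Re (z p i) + M; pose im p i := complex.Im (z p i) + M.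
have bnd (u : K) : `|u| <= M -> 0 <= u + M <= 2 * M.
  by rewrite ler_norml => /andP[? ?]; apply/andP; split; lra.
have reP p i : 0 <= re p i <= 2 * M by apply: bnd; exact: le_trans (nrm_Re _) (zM p i).
have imP p i : 0 <= im p i <= 2 * M by apply: bnd; exact: le_trans (nrm_Im _) (zM p i).
pose tr (u : K) := Num.truncn (u * (2 / e)).
have trN (u : K) : 0 <= u <= 2 * M -> (tr u < N.+1)%N.
  move=> /andP[u0 uM]; rewrite ltnS; apply: le_truncn.
  rewrite (_ : 4 * M / e = 2 * M * (2 / e)); last by ring.
  by rewrite ler_wpM2r // divr_ge0 // ltW.
pose code (p : nat) : {ffun 'I_m -> 'I_N.+1 * 'I_N.+1} :=
  [ffun i => (inord (tr (re p i)), inord (tr (im p i)))].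
have close p j : code p = code j -> forall i, nrm (z p i - z j i) <= e.
  move=> /ffunP pj i; have := pj i;
    rewrite !ffunE => -[] /(congr1 val) /= e1 /(congr1 val) /=.
  rewrite !inordK ?trN // => e2; rewrite !inordK ?trN // in e1.
  have /andP[r1 _] := reP p i; have /andP[r2 _] := reP j i.
  have /andP[i1 _] := imP p i; have /andP[i2 _] := imP j i.
  have := trunc_close _ _ r1 r2 e1; have := trunc_close _ _ i1 i2 e2.
  have addM (u v : K) : (u + M) - (v + M) = u - v by ring.
  rewrite /re /im !addM => h2 h1; rewrite (le_trans (nrm_ReIm _)) //.
  have -> : complex.Re (z p i - z j i) = complex.Re (z p i) - complex.Re (z j i).
    by case: (z p i) (z j i) => ? ? [].
  have -> : complex.Im (z p i - z j i) = complex.Im (z p i) - complex.Im (z j i).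
    by case: (z p i) (z j i) => ? ? [].
  by have := lerD h1 h2; rewrite -splitr.
apply: contrapT => far.
have inj : injective (fun i : 'I_(#|{: {ffun 'I_m -> 'I_N.+1 * 'I_N.+1}}|.+1) => code i).
  move=> i j ij; apply/val_inj/eqP; apply: contraT; rewrite neq_ltn => /orP[lt_ij|lt_ji].
    by exfalso; apply: far; exists i, j; split=> //; exact: close.
  by exfalso; apply: far; exists j, i; split=> //; exact: close.
by have := leq_card _ inj; rewrite card_ord ltnn.
Qed.

(** Along a strictly increasing chain of null spaces, Riesz's lemma gives [y p] of
    norm at most [2] with [b ^ n (y p)] at distance at least [1] from all the
    earlier [b ^ n (y j)]. The small part of [b ^ n] accounts for at most
    [8^-1 * 4], and two of the images under the finite-rank part are within
    [4^-1]. *)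
Lemma finite_ascent_one_sub b n c : ess_norm_le (cls b ^+ n) c -> c <= 8^-1 -> bounded b ->
  finite_ascent (1 - b).
Proof.
move=> [D Db Dc] c8 bb; apply: contrapT => nfa.
have bF : bounded (b ^+ n - D).
  by apply: boundedB; [exact: boundedX | exists c].
have [m [v [f [fb FE]]]] : exists m (v : 'I_m -> X) (f : 'I_m -> X -> K[i]),
    (forall i, bounded_form (f i)) /\ forall x, (b ^+ n - D) x = lincomb (fun i => f i x) v.
  by apply: finite_rank_bounded_coord => //; apply/clsP; rewrite clsX.
set L := 1 - b in nfa.
have bL : bounded L by apply: boundedB => //; exact: bounded1.
have /choice[y yP] p : exists y, [/\ (L ^+ p.+1) y = 0, nrm y <= 2
    & forall m, (L ^+ p) m = 0 -> 1 <= nrm (y - m)].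
  have [x [Lx Lx0]] : exists x, (L ^+ p.+1) x = 0 /\ (L ^+ p) x <> 0.
    apply: contrapT => nx; apply: nfa; exists p => x Lx.
    by apply: contrapT => Lx0; apply: nx; exists x.
  exact: riesz_null_chain bL Lx Lx0.
have bnL : GRing.comm (b ^+ n) L.
  apply: commrB; first exact: commr1.
  by apply: commr_sym; apply: commrX; exact: commr_refl.
have Lbn k x : (L ^+ k) x = 0 -> (L ^+ k) ((b ^+ n) x) = 0.
  by move=> Lx; rewrite -endoME -(commrX k bnL) endoME Lx app0.
have up j p x : (j <= p)%N -> (L ^+ j) x = 0 -> (L ^+ p) x = 0.
  by move=> jp Lx; rewrite -(subnK jp) exprD endoME Lx app0.
have far j p : (j < p)%N -> 1 <= nrm ((b ^+ n) (y p) - (b ^+ n) (y j)).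
  move=> jp; have [Lp _ yp] := yP p; have [Lj _ _] := yP j.
  have {}Lj := up _ _ _ jp Lj.
  have -> : (b ^+ n) (y p) - (b ^+ n) (y j)
      = y p - ((1 - b ^+ n) (y p) + (b ^+ n) (y j)).
    by rewrite endoBE endo1E opprD opprB addrA [y p + _]addrC subrK.
  apply: yp; rewrite appD Lbn // addr0.
  have sL : GRing.comm (\sum_(i < n) b ^+ i) (L ^+ p).
    by apply: commrX; apply: commr_sym; exact: comm_geometric_sum.
  by rewrite -geometric_sum_mul -endoME mulrA -sL -mulrA -exprSr endoME Lp app0.
pose S := \sum_i nrm (v i); have S0 : 0 <= S by apply: sumr_ge0 => i _; exact: nrm_ge0.
have [M fM] : exists M, forall p i, nrm (f i (y p)) <= M.
  have /choice[C CP] i : exists C, 0 <= C /\ forall x, nrm (f i x) <= C * nrm x.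
    by have [_ [C C0 fC]] := fb i; exists C.
  have [M M0 CM] := finite_upper_bound C.
  exists (M * 2) => p i; have [C0 fC] := CP i; have [_ y2 _] := yP p.
  by rewrite (le_trans (fC _)) // ler_pM // nrm_ge0.
have eta0 : 0 < 4^-1 / (S + 1) by rewrite divr_gt0 ?invr_gt0 //; lra.
have [j [p [jp closejp]]] := bounded_sequence_close_terms fM eta0.
have := far _ _ jp; have [_ yp2 _] := yP p; have [_ yj2 _] := yP j.
have [c0 Dn] := Dc.
have bnE x : (b ^+ n) x = D x + (b ^+ n - D) x by rewrite endoBE addrC subrK.
have d1 : nrm (D (y p) - D (y j)) <= 2^-1.
  have y4 : nrm (y p - y j) <= 4 by apply: le_trans (nrmB _ _) _; lra.
  rewrite -appB (le_trans (Dn _)) // (le_trans (ler_pM c0 (nrm_ge0 _) c8 y4)) //.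
  lra.
have d2 : nrm ((b ^+ n - D) (y p) - (b ^+ n - D) (y j)) <= 4^-1.
  rewrite !FE -lincombB (le_trans (nrm_sum _)) //.
  apply: (@le_trans _ _ (4^-1 / (S + 1) * S)).
    by rewrite mulr_sumr; apply: ler_sum => i _; rewrite nrmZ ler_wpM2r ?nrm_ge0.
  rewrite -mulrA ler_piMr ?invr_ge0 // mulrC ler_pdivrMr; lra.
rewrite !bnE opprD addrACA => /le_trans/(_ (nrmD _ _)); lra.
Qed.

End PerturbationOfIdentity.

(** * Riesz perturbations and spectra *)

Section RieszPerturbation.
Context {K : realType} {X : completeNormedModType K[i]}.
Implicit Types (a b r u v : endo X) (c rho : K).

(** Only exponents that are powers of two are considered: they suffice to find
    one small power. *)
Definition quasinilpotent_mod r : Prop :=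
  forall rho : K, 0 <= rho -> powers_vanish (cls r) rho.

(** For [z != 0], [1 - z r] is [- z (r - z^-1)]. *)
Lemma riesz_quasinilpotent r : bounded r ->
  (forall z : K[i], z != 0 -> fredholm (r - scal z)) -> quasinilpotent_mod r.
Proof.
move=> br fr rho; apply: riesz_powers_vanish; first by have [c rc] := br; exists c, r.
move=> z; have [->|z0] := eqVneq z 0.
  exists 1, (nrm 1); split; last by rewrite -cscal1; exact: ess_norm_le_cscal.
  by split; rewrite cscal0 mul0r subr0 mulr1.
have br' : bounded (r - scal z^-1) by apply: boundedB => //; exact: bounded_scal.
have zV0 : z^-1 != 0 by rewrite invr_eq0.
have [p [[c pc] pr rp]] := fredholm_bounded_parametrix br' (fr _ zV0).
rewrite !(clsM, clsB) -/(cscal _) in pr rp.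
exists (- (cscal z^-1 * cls p)), (nrm z^-1 * c); split; last first.
  by apply: ess_norm_leN; apply: ess_norm_leM; [exact: ess_norm_le_cscal | exists p].
have zE : 1 - cscal z * cls r = - (cscal z * (cls r - cscal z^-1)).
  by rewrite mulrBr -cscalM divff // cscal1 opprB.
have zz : cscal z * cscal z^-1 = 1 :> calkin X by rewrite -cscalM divff // cscal1.
split; rewrite zE mulrNN.
  by rewrite mulrA -(cscalC z^-1) (mulrA (cscal z^-1)) -cscalM mulVf // cscal1 mul1r rp.
by rewrite (mulrA _ (cscal z)) -(cscalC z) (mulrA (cscal z)) zz mul1r pr.
Qed.

Lemma quasinilpotent_modN r : quasinilpotent_mod r -> quasinilpotent_mod (- r).
Proof.
move=> qr rho rho0 e e0; have [k0 kP] := qr rho rho0 e e0.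
exists k0 => k /kP; rewrite clsN mulrN exprNn -signr_odd mulr_sign.
by case: odd => // h; exact: ess_norm_leN.
Qed.

(** The powers of the commuting product split, and those of [v] grow at most
    geometrically, which a large enough radius for [r] absorbs. *)
Lemma small_power_of_product r v b c : quasinilpotent_mod r -> bounded v ->
  cls v * cls r = cls r * cls v -> cls b = cls v * cls r -> 0 < c ->
  exists n, ess_norm_le (cls b ^+ n) c.
Proof.
move=> qr [M [M0 vM]] vr bE c0; have M1 : 0 < M + 1 by lra.
have [k kP] := qr (M + 1) (ltW M1) c c0; exists (2 ^ k)%N.
have {kP} := kP k (leqnn k); set n := (2 ^ k)%N => kP.
have vM1 : op_norm_le v (M + 1) by apply: op_norm_le_weaken (conj M0 vM); lra.
have scV : cls b ^+ n = (cscal ((M + 1)^-1 ^+ n)%:C%C * cls v ^+ n) *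
    (cscal (M + 1)%:C%C * cls r) ^+ n.
  rewrite bE exprMn_comm // cscalZX [RHS]mulrA -cscalC !mulrA -cscalM.
  rewrite -(rmorphXn (real_complex K)) -(rmorphM (real_complex K)) /=.
  by rewrite -exprMn mulfV ?gt_eqF // expr1n cscal1 mul1r.
rewrite scV; apply: (@ess_norm_le_weaken _ _ _ (((M + 1)^-1 ^+ n * (M + 1) ^+ n) * c)).
  by rewrite -exprMn mulVf ?gt_eqF // expr1n mul1r.
apply: ess_norm_leM => //; apply: ess_norm_leM; last first.
  by exists (v ^+ n); [exact: clsX | exact: op_norm_leX].
have s0 : 0 <= (M + 1)^-1 ^+ n by rewrite exprn_ge0 // invr_ge0 ltW.
by rewrite -[X in ess_norm_le _ X](ger0_norm s0) -nrmR; exact: ess_norm_le_cscal.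
Qed.

(** If [u] is a bounded invertible operator equal to [a] modulo finite rank and
    [v] its inverse, then [a - r] is [u (1 - v r)] modulo finite rank; here [v]
    and [r] commute modulo finite rank only. *)
Lemma weyl_mod_sub_quasinilpotent a r : bounded a -> bounded r ->
  quasinilpotent_mod r -> a * r = r * a -> weyl a -> weyl_mod (a - r).
Proof.
move=> ba br qr ar /(weyl_bounded ba)[u [v [uv vu bu bv au]]].
have ur : cls u * cls r = cls r * cls u by rewrite -au -!clsM ar.
have vu1 : cls v * cls u = 1 by rewrite -clsM vu cls1.
have uv1 : cls u * cls v = 1 by rewrite -clsM uv cls1.
have vr : cls v * cls r = cls r * cls v.
  by rewrite -[LHS]mulr1 -uv1 -mulrA [cls r * _]mulrA -ur mulrA mulrA vu1 mul1r.
have h2 : 0 < 2^-1 :> K by rewrite invr_gt0.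
have [n bn] := small_power_of_product qr bv vr (clsM v r) h2.
have w1 : weyl_mod (1 - v * r) by apply: weyl_mod_one_sub bn (lexx _) _; exact: boundedM.
have wu : weyl_mod u := weyl_mod_inv uv vu.
apply: weyl_mod_congr (weyl_modM wu w1).
by rewrite mulrBr mulr1 mulrA uv mul1r !clsB au.
Qed.

(** With the spectral projection [q] of [a], the operator [u = a + q] commutes with
    [r] and [q], and [a - r = u (1 - b)] exactly, for [b = u^-1 (r + q)]; modulo
    finite rank [b] is [u^-1 r]. *)
Lemma browder_sub_quasinilpotent a r : bounded a -> bounded r ->
  quasinilpotent_mod r -> a * r = r * a -> browder a -> browder (a - r).
Proof.
move=> ba br qr ar bra.
have [k [q [[qa aq qN dec] qF qC [v [uv vu]]]]] := browder_projection bra.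
have bq : bounded q by have [_ _ fN] := bra; exact: browder_projection_bounded qa aq qN dec.
set u := a + q in uv vu; have bu : bounded u by exact: boundedD.
have bv : bounded v by exact: bounded_inverse uv vu.
have qr' : q * r = r * q by exact: qC.
have qa' : q * a = a * q by exact: qC.
have us : u * (r + q) = (r + q) * u.
  by rewrite /u mulrDl !mulrDr !mulrDl ar qr' qa' addrACA [a * q + _]addrC -addrACA.
have ur : u * r = r * u by rewrite /u mulrDl mulrDr ar qr'.
have vr : v * r = r * v.
  by rewrite -[LHS]mulr1 -uv -mulrA [r * _]mulrA -ur mulrA mulrA vu mul1r.
pose b := v * (r + q).
have bb : bounded b by apply: boundedM => //; exact: boundedD.
have bE : cls b = cls v * cls r by rewrite clsM clsD (cls_finite_rank qF) addr0.
have vrc : cls v * cls r = cls r * cls v by rewrite -!clsM vr.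
have h8 : 0 < 8^-1 :> K by rewrite invr_gt0.
have [n bn] := small_power_of_product qr bv vrc bE h8.
have e2 : 8^-1 <= 2^-1 :> K by lra.
have w1 := weyl_mod_one_sub bn e2 bb.
have [p fp] := finite_ascent_one_sub bn (lexx _) bb.
have abE : a - r = u * (1 - b).
  by rewrite mulrBr mulr1 /b mulrA uv mul1r opprD [- r - q]addrC addrA addrK.
have ub : GRing.comm u (1 - b).
  apply: commrB; first exact: commr1.
  by rewrite /GRing.comm /b mulrA uv -mulrA -us mulrA vu !mul1r.
rewrite abE; apply: weyl_mod_browder.
  exact: weyl_modM (weyl_mod_inv uv vu) w1.
exists p => x; rewrite !exprMn_comm // !endoME => ux.
rewrite fp ?app0 //.
have vuX j : v ^+ j * u ^+ j = 1.
  by rewrite -exprMn_comm ?vu ?expr1n // /GRing.comm vu uv.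
by move: (congr1 (v ^+ p.+1) ux); rewrite app0 -endoME vuX.
Qed.

End RieszPerturbation.

Section Spectra.
Context {K : realType} {X : completeNormedModType K[i]}.
Implicit Types (S : {linear X -> X}) (l : K[i]) (a : endo X).

Definition endo_of S : endo X := Endo (linearP S).
Definition sub_scal S l : endo X := endo_of S - scal l.
Definition invertible a : Prop := exists v, a * v = 1 /\ v * a = 1.

Lemma sub_scalE S l : sub_scalar S l = sub_scal S l :> (X -> X).
Proof. by []. Qed.

Lemma bounded_opP S : bounded_op S <-> bounded (endo_of S).
Proof.
split=> [[M SM]|[c [c0 Sc]]]; last first.
  by exists c%:C%C => x; rewrite !normE -(rmorphM (real_complex K)) lecR; exact: Sc.
exists (nrm M); split=> [|x]; first exact: nrm_ge0.
have Mx : 0 <= M * `|x| by exact: le_trans (SM x).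
by rewrite -lecR (rmorphM (real_complex K)) /= -!normE -[`|x|]normr_id -normrM ger0_norm // SM.
Qed.

Lemma bounded_sub_scal S l : bounded_op S -> bounded (sub_scal S l).
Proof. by move=> /bounded_opP bS; apply: boundedB => //; exact: bounded_scal. Qed.

Lemma invertible_opP S l : bounded_op S ->
  invertible_op (sub_scalar S l) <-> invertible (sub_scal S l).
Proof.
move=> bS; split=> [[U [_ US SU]]|[v [av va]]].
  by exists (endo_of U); split; apply: endoP => x; [exact: SU | exact: US].
have /bounded_opP bv : bounded (endo_of v).
  have [c [c0 vc]] := bounded_inverse (bounded_sub_scal l bS) av va.
  by exists c.
exists v; split=> // x; first by rewrite -[RHS](congr1 (fun b : endo X => b x) va).
by rewrite -[RHS](congr1 (fun b : endo X => b x) av).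
Qed.

Lemma spectrumP S l : bounded_op S -> spectrum S l <-> ~ invertible (sub_scal S l).
Proof. by move=> bS; rewrite -(propext (invertible_opP l bS)). Qed.

Lemma finite_rank_polesP S l : bounded_op S ->
  finite_rank_poles S l <-> ~ invertible (sub_scal S l) /\ browder (sub_scal S l).
Proof.
move=> bS; rewrite -(propext (spectrumP l bS)).
split=> [[[sS asc desc] fN]|[sS [fa fd fN]]].
  by split=> //; split=> //;
    [exact/(ascentP (sub_scal S l)) | exact/(descentP (sub_scal S l))].
by split=> //; split=> //;
  [exact/(ascentP (sub_scal S l)) | exact/(descentP (sub_scal S l))].
Qed.

Lemma invertible_browder a : invertible a -> browder a.
Proof.
move=> [v [av va]]; split.
- by exists 0%N => x; rewrite expr1 expr0 => ax; rewrite -va endoME ax app0.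
- by exists 0%N => x; exists (v x); rewrite expr1 expr0 -endoME av.
- apply: (@finite_dim_span _ _ _ 0 (fun=> 0)); first exact: subspace_null.
  move=> x /null_spaceP ax; exists (fun=> 0); rewrite lincomb0.
  by rewrite -[x]endo1E -va endoME ax app0.
Qed.

Lemma weyl_injective_invertible a : weyl a -> (forall x, a x = 0 -> x = 0) ->
  invertible a.
Proof.
move=> /weyl_has_dim[n [dn [b [_ sp _]]]] inj; apply: bij_invertible => // y.
have n0 : n = 0%N.
  apply: has_dim_uniq dn _; exists (fun=> 0); split=> [[//]|x /inj ->|c _ []//].
  by exists (fun=> 0); rewrite big_ord0 subr0.
subst n; have [c [x _ xE]] := sp y I.
by exists x; rewrite xE big_ord0 subr0.
Qed.

Lemma weyl_bounded_below_invertible S l : bounded_op S ->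
  bounded_below (sub_scalar S l) -> weyl (sub_scal S l) -> invertible (sub_scal S l).
Proof.
move=> bS [c c0 Sc] wS; apply: weyl_injective_invertible => // x ax.
apply/eqP; rewrite -normr_le0 -(pmulr_rle0 _ c0).
by apply: le_trans (Sc x) _; rewrite [sub_scalar S l x]ax normr0.
Qed.

(** A Weyl operator that is bounded below is injective, hence invertible; and the
    powers of a Weyl operator have closed range. *)
Lemma finite_rank_pole_left_pole S l : bounded_op S ->
  finite_rank_poles S l -> left_poles S l.
Proof.
move=> bS /(finite_rank_polesP l bS)[nI bra]; have wa := browder_weyl_mod bra.
split.
  by move=> bb; apply: nI; exact: weyl_bounded_below_invertible bb (weyl_mod_weyl wa).
have [fa _ _] := bra; have /ascentP := fa.
case E : (ascent (sub_scal S l)) => [p|//] _; exists p => //.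
rewrite sub_scalE iter_endo; apply: closed_range.
  exact/boundedX/bounded_sub_scal.
have [_ c] := weyl_mod_weyl (weyl_modX p.+1 wa).
by have [[_ fc] _] := weyl_mod_weyl (weyl_modX p.+1 wa).
Qed.

Lemma finite_rank_pole_weyl S l : bounded_op S ->
  finite_rank_poles S l -> (spectrum S `\` weyl_spectrum S) l.
Proof.
move=> bS /(finite_rank_polesP l bS)[nI bra]; split; first exact/spectrumP.
by apply; exact: weyl_mod_weyl (browder_weyl_mod bra).
Qed.

Lemma weyl_left_pole_browder S l : bounded_op S ->
  weyl (sub_scal S l) -> left_poles S l -> browder (sub_scal S l).
Proof.
move=> bS wS [_ [p ap _]]; apply: weyl_mod_browder.
  by apply: weyl_weyl_mod => //; exact: bounded_sub_scal.
by apply/ascentP; rewrite -[ascent _]/(ascent (sub_scalar S l)) ap.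
Qed.

Lemma left_pole_spectrum S l : left_poles S l -> spectrum S l.
Proof.
move=> [nb _] [U [[M UM] US _]]; apply: nb.
have M0 : 0 < `|M| + 1 by rewrite ltr_wpDl.
exists (`|M| + 1)^-1; first by rewrite invr_gt0.
move=> x; rewrite ler_pdivrMl // -{1}[x]US.
have Mx : 0 <= M * `|sub_scalar S l x| by exact: le_trans (UM _).
apply: (le_trans (UM _)); rewrite -(ger0_norm Mx) normrM normr_id.
by rewrite ler_wpM2r // lerDl.
Qed.

End Spectra.

Theorem theorem3p5 (K : realType) (X : completeNormedModType K[i])
    (R T : {linear X -> X}) :
  ~ finite_dim [set: X] ->
  bounded_op R -> riesz R ->
  bounded_op T -> property_ZPia T ->
  (forall x, T (R x) = R (T x)) ->
  let TR : {linear X -> X} := T \+ R in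
  (property_ZPia TR <-> finite_rank_poles TR = left_poles TR) /\
  (finite_rank_poles TR = left_poles TR <->
     left_poles TR `&` spectrum T `<=` finite_rank_poles T).
Proof.
move=> _ bR rR bT ZT TRC TR.
have /bounded_opP br := bR; have bt l := bounded_sub_scal l bT.
have bTR : bounded_op TR.
  by apply/bounded_opP; apply: (@boundedD _ _ (endo_of T) (endo_of R)) => //;
    exact/bounded_opP.
have btr l := bounded_sub_scal l bTR.
have qR : quasinilpotent_mod (endo_of R) by exact: riesz_quasinilpotent.
have shTR l : sub_scal TR l = sub_scal T l + endo_of R.
  by rewrite /sub_scal addrAC; congr (_ - _); exact: endoP.
have comm l : sub_scal T l * endo_of R = endo_of R * sub_scal T l.
  rewrite mulrBl mulrBr scalC; congr (_ - _); exact: endoP.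
have commTR l : sub_scal TR l * endo_of R = endo_of R * sub_scal TR l.
  by rewrite shTR mulrDl mulrDr comm.
have shT l : sub_scal T l = sub_scal TR l - endo_of R by rewrite shTR addrK.
have browderT l : browder (sub_scal TR l) -> browder (sub_scal T l).
  by rewrite shT; apply: browder_sub_quasinilpotent.
have browderTR l : browder (sub_scal T l) -> browder (sub_scal TR l).
  rewrite shTR -[endo_of R]opprK; apply: browder_sub_quasinilpotent => //.
  - exact: boundedN.
  - exact: quasinilpotent_modN.
  - by rewrite mulrN mulNr comm.
have weylT l : weyl (sub_scal TR l) -> weyl (sub_scal T l).
  by rewrite shT => w; apply/weyl_mod_weyl/weyl_mod_sub_quasinilpotent.
(* Where [TR - l] is Weyl so is [T - l], which the property of [T] makes Browder. *)
have weyl_browderTR l : weyl (sub_scal TR l) -> browder (sub_scal TR l).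
  move=> /weylT wT; apply: browderTR.
  have [/invertible_browder//|nI] := pselect (invertible (sub_scal T l)).
  apply: weyl_left_pole_browder => //; rewrite -ZT; split; first exact/spectrumP.
  by apply.
split; split.
- move=> ZTR; apply/seteqP; split=> l; first exact: finite_rank_pole_left_pole.
  move=> lp; move: (lp); rewrite -ZTR => -[sl /contrapT wl].
  apply/finite_rank_polesP => //; split; first exact/spectrumP.
  exact: weyl_browderTR.
- move=> PTR; apply/seteqP; split=> l; last first.
    by rewrite -PTR; exact: finite_rank_pole_weyl.
  move=> [sl /contrapT wl]; rewrite -PTR; apply/finite_rank_polesP => //.
  by split; [exact/spectrumP | exact: weyl_browderTR].
- move=> PTR l [lp sl]; apply/finite_rank_polesP => //; split; first exact/spectrumP.
  by move: lp; rewrite -PTR => /(finite_rank_polesP l bTR)[_ /browderT].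
- move=> H; apply/seteqP; split=> l; first exact: finite_rank_pole_left_pole.
  move=> lp; have sl := left_pole_spectrum lp.
  apply/finite_rank_polesP => //; split; first exact/spectrumP.
  apply: browderTR; have [/invertible_browder//|nI] := pselect (invertible (sub_scal T l)).
  have : finite_rank_poles T l by apply: H; split=> //; exact/spectrumP.
  by move=> /(finite_rank_polesP l bT)[].
Qed.
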